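(* The property of being an odometer on the Cantor set is not separably axiomatizable: there is no $\mathcal{L}$-theory $T$ whose separable models are exactly (up to isomorphism) the structures $(C(2^{\mathbb{N}}),\sigma)$ with $\sigma$ (induced by) an odometer on the Cantor set $2^{\mathbb{N}}$.
   Context: Let $\mathcal{L}_{C^*}$ be the language of unital C*-algebras (continuous logic) and $\mathcal{L}$ its expansion by a unary function symbol $\sigma$. A compact metrizable space $X$ with a homeomorphism $S$ corresponds to the $\mathcal{L}$-structure $(C(X),\sigma)$ with $\sigma(f)=f\circ S$. A property $P$ of dynamical systems is separably axiomatizable (for a class $\mathcal{C}$ of compact metrizable spaces) if there is an $\mathcal{L}$-theory $T$ whose separable models are exactly the structures $(C(X),\sigma)$ with $X\in\mathcal{C}$ and $\sigma$ satisfying $P$. Odometers: given integers $a_n\ge 2$, let $A_n=\{0,\dots,a_n-1\}$, $X=\prod_n A_n$ with the product topology, and $\sigma:X\to X$ defined by: if $b_1<a_1-1$ then $\sigma(b)=(b_1+1,b_2,\dots)$; otherwise $\sigma(b)=(0,\dots,0,b_n+1,b_{n+1},\dots)$ with $n$ least such that $b_n<a_n-1$, and $\sigma(b)=(0,0,\dots)$ if no such $n$ exists. An odometer is any system topologically conjugate to such a system. *)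

(* Defs.v *)
From HB Require Import structures.
From mathcomp Require Import all_boot all_order all_algebra.
From mathcomp Require Import all_classical all_reals all_analysis.
From mathcomp Require Import complex ring lra.

Set Implicit Arguments.
Unset Strict Implicit.
Unset Printing Implicit Defensive.

Import Order.TTheory GRing.Theory Num.Theory Normc.
Import numFieldNormedType.Exports.

Local Open Scope classical_set_scope.
Local Open Scope ring_scope.
Local Open Scope complex_scope.

(* [R[i]] seen as a [numFieldType], which gives it its usual topology. *)
Definition complexes (R : realType) : numFieldType := R[i].

(* A language of continuous logic has one sort with domains of quantification,
   each function symbol carrying, for every choice of domains for its arguments,
   a domain for its value and a modulus of uniform continuity.  For unital
   C*-algebras the domain [D_n] stands for the closed ball of radius [n], so that
   the domains and moduli below are the ones that hold for the operations of a
   C*-algebra.  Since *-homomorphisms are contractive, the symbol [sigma] maps each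
   [D_n] to [D_n] and is 1-Lipschitz.  No C*-algebra axiom is part of the definition
   of a structure: those belong to theories. *)
Record structure (R : realType) := Structure {
  carrier :> metricType R;
  dom : nat -> set carrier;
  op_zero : carrier;
  op_one : carrier;
  op_add : carrier -> carrier -> carrier;
  op_mul : carrier -> carrier -> carrier;
  op_star : carrier -> carrier;
  op_scale : R[i] -> carrier -> carrier;
  op_sigma : carrier -> carrier;
  dom_cover : forall x, exists n, dom n x;
  dom_bounded : forall n x y, dom n x -> dom n y -> mdist x y <= (2 * n)%N%:R;
  dom_complete : forall n (u : nat -> carrier), (forall k, dom n (u k)) ->
    cauchy (u @ \oo) -> exists2 x, dom n x & u @ \oo --> x;
  dom_zero : dom 0 op_zero;
  dom_one : dom 1 op_one;
  dom_add : forall m n x y, dom m x -> dom n y -> dom (m + n)%N (op_add x y);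
  dom_mul : forall m n x y, dom m x -> dom n y -> dom (m * n)%N (op_mul x y);
  dom_star : forall n x, dom n x -> dom n (op_star x);
  dom_scale : forall m n l x,
    normc l * m%:R <= n%:R -> dom m x -> dom n (op_scale l x);
  dom_sigma : forall n x, dom n x -> dom n (op_sigma x);
  mod_add : forall m n x x' y y', dom m x -> dom m x' -> dom n y -> dom n y' ->
    mdist (op_add x y) (op_add x' y') <= mdist x x' + mdist y y';
  mod_mul : forall m n x x' y y', dom m x -> dom m x' -> dom n y -> dom n y' ->
    mdist (op_mul x y) (op_mul x' y') <= n%:R * mdist x x' + m%:R * mdist y y';
  mod_star : forall n x y, dom n x -> dom n y ->
    mdist (op_star x) (op_star y) <= mdist x y;
  mod_scale : forall n l x y, dom n x -> dom n y ->
    mdist (op_scale l x) (op_scale l y) <= normc l * mdist x y;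
  mod_sigma : forall n x y, dom n x -> dom n y ->
    mdist (op_sigma x) (op_sigma y) <= mdist x y
}.

(* The free variables of [term R n] and [formula R n] are indexed by ['I_n]. *)
Inductive term (R : realType) (n : nat) : Type :=
| TVar of 'I_n
| TZero
| TOne
| TAdd of term R n & term R n
| TMul of term R n & term R n
| TStar of term R n
| TScale of R[i] & term R n
| TSigma of term R n.

(* [FSup m phi] and [FInf m phi] quantify over [D_m] and bind variable [ord0] of
   [phi].  The norm of [t] is [FDist t TZero]. *)
Inductive formula (R : realType) : nat -> Type :=
| FDist n of term R n & term R n : formula R n
| FConn n k (u : 'rV[R]_k -> R) of continuous u & ('I_k -> formula R n) :
    formula R n
| FSup n of nat & formula R n.+1 : formula R n
| FInf n of nat & formula R n.+1 : formula R n.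

Section Semantics.
Variables (R : realType) (M : structure R).

Definition env_cons n (x : M) (e : 'I_n -> M) : 'I_n.+1 -> M :=
  fun i => oapp e x (unlift ord0 i).

Fixpoint eval_term n (e : 'I_n -> M) (t : term R n) : M :=
  match t with
  | TVar i => e i
  | TZero => op_zero M
  | TOne => op_one M
  | TAdd t1 t2 => op_add (eval_term e t1) (eval_term e t2)
  | TMul t1 t2 => op_mul (eval_term e t1) (eval_term e t2)
  | TStar t1 => op_star (eval_term e t1)
  | TScale l t1 => op_scale l (eval_term e t1)
  | TSigma t1 => op_sigma (eval_term e t1)
  end.

Fixpoint eval n (phi : formula R n) : ('I_n -> M) -> R :=
  match phi in formula _ n return ('I_n -> M) -> R with
  | FDist _ t1 t2 => fun e => mdist (eval_term e t1) (eval_term e t2)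
  | FConn _ _ u _ psi => fun e => u (\row_i eval (psi i) e)
  | FSup _ m psi => fun e => sup [set eval psi (env_cons x e) | x in dom m]
  | FInf _ m psi => fun e => inf [set eval psi (env_cons x e) | x in dom m]
  end.

(* ['I_0] being empty, the assignment used for sentences is irrelevant. *)
Definition sentence_value (phi : formula R 0) : R := eval phi (fun=> op_zero M).

Definition models (T : set (formula R 0)) : Prop :=
  forall phi, T phi -> sentence_value phi = 0.

Definition separable : Prop := exists A : set M, countable A /\ dense A.

End Semantics.

Definition isomorphic (R : realType) (M N : structure R) : Prop :=
  exists f : M -> N,
    bijective f
    /\ (forall x y, mdist (f x) (f y) = mdist x y)
    /\ (forall n x, dom n (f x) <-> dom n x)
    /\ f (op_zero M) = op_zero N
    /\ f (op_one M) = op_one N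
    /\ {morph f : x y / op_add x y}
    /\ {morph f : x y / op_mul x y}
    /\ {morph f : x / op_star x}
    /\ (forall l, {morph f : x / op_scale l x})
    /\ {morph f : x / op_sigma x}.

(* Some theory has the members of [K] as its separable models, up to
   isomorphism. *)
Definition separably_axiomatizable (R : realType) (K : structure R -> Prop) :
    Prop :=
  exists T : set (formula R 0), forall M : structure R,
    (separable M /\ models M T) <-> (exists2 N, K N & isomorphic M N).

Section ComplexFacts.
Variable R : realType.
Implicit Types (z : R[i]).

Lemma norm_normc z : `|z| = (normc z)%:C.
Proof. by []. Qed.

Lemma normc_ge0 z : 0 <= normc z.
Proof. by rewrite -lecR -norm_normc; exact: normr_ge0. Qed.

Lemma normcB z w : normc (z - w) = normc (w - z).
Proof. by rewrite -normcN opprB. Qed.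

Lemma normc_conj z : normc z^* = normc z.
Proof. by case: z => a b; rewrite /normc /= sqrrN. Qed.

Lemma normc_triangle w z1 z2 : normc (z1 - z2) <= normc (z1 - w) + normc (w - z2).
Proof. by rewrite (le_trans _ (le_normcD _ _))// addrA subrK. Qed.

Lemma normc_le_ReIm z : normc z <= `|complex.Re z| + `|complex.Im z|.
Proof.
case: z => a b /=; rewrite -[leRHS]ger0_norm ?addr_ge0// -sqrtr_sqr.
rewrite ler_wsqrtr// sqrrD !real_normK ?num_real// -addrAC.
by rewrite lerDl mulrn_wge0// mulr_ge0.
Qed.

Lemma Re_le_normc z : `|complex.Re z| <= normc z.
Proof.
by case: z => a b /=; rewrite -sqrtr_sqr ler_wsqrtr// lerDl sqr_ge0.
Qed.

Lemma Im_le_normc z : `|complex.Im z| <= normc z.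
Proof.
by case: z => a b /=; rewrite -sqrtr_sqr ler_wsqrtr// lerDr sqr_ge0.
Qed.

Lemma cauchy_normc_cvg (v : nat -> R[i]) :
  (forall e : R, 0 < e -> exists N, forall i j, (N <= i)%N -> (N <= j)%N ->
    normc (v i - v j) < e) ->
  exists l : R[i], forall e : R, 0 < e -> \forall k \near \oo, normc (v k - l) < e.
Proof.
move=> vC.
have cv (p : R[i] -> R) : (forall z w, `|p z - p w| <= normc (z - w)) ->
    exists l : R, p (v k) @[k --> \oo] --> l.
  move=> pL; apply/cvg_ex; apply/cauchy_cvgP; apply/cauchy_exP => e e0.
  have [N HN] := vC _ e0; exists (p (v N)); exists N => // k /= Nk.
  by rewrite /ball /=; apply: le_lt_trans (pL _ _) _; exact: HN.
have [a /cvgrPdist_lt va] : exists l : R, complex.Re (v k) @[k --> \oo] --> l.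
  by apply: cv => z w; rewrite -raddfB; exact: Re_le_normc.
have [b /cvgrPdist_lt vb] : exists l : R, complex.Im (v k) @[k --> \oo] --> l.
  by apply: cv => z w; rewrite -raddfB; exact: Im_le_normc.
exists (a +i* b) => e e0; have e20 : 0 < e / 2 by rewrite divr_gt0.
near=> k; apply: le_lt_trans (normc_le_ReIm _) _; rewrite (splitr e) ltrD//.
  by rewrite raddfB /= distrC; near: k; exact: va.
by rewrite raddfB /= distrC; near: k; exact: vb.
Unshelve. all: by end_near. Qed.

Lemma ccvgP (X : topologicalType) (f : X -> complexes R) (x : X) :
  f y @[y --> x] --> f x <->
  forall e : R, 0 < e -> \forall y \near x, normc (f x - f y) < e.
Proof.
split=> [/cvgrPdist_lt fx e e0|fx].
  have e0' : 0 < e%:C :> complexes R by rewrite ltcR.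
  by apply: filterS (fx _ e0') => y /=; rewrite norm_normc ltcR.
apply/cvgrPdist_lt => -[e e'].
rewrite ltcE /= => /andP[/eqP -> e0].
by apply: filterS (fx _ e0) => y /=; rewrite norm_normc ltcR.
Qed.

End ComplexFacts.

(* [C(X)] for compact [X], with the metric of the supremum norm. *)
Definition cfun (R : realType) (X : topologicalType) (cX : compact [set: X]) :
  Type := continuousType X (complexes R).

Section ContinuousFunctions.
Variables (R : realType) (X : topologicalType) (cX : compact [set: X]).
Local Notation C := (complexes R).
Local Notation CX := (@cfun R X cX).
Implicit Types f g h : CX.

HB.instance Definition _ := Choice.on CX.

Definition eval_cfun f : X -> C := f : continuousType X C.
Local Coercion eval_cfun : cfun >-> Funclass.

Definition mk_cfun (f : X -> C) (hf : continuous f) : CX :=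
  (mkcts hf : continuousType X C).

Definition supnorm (f : X -> C) : R := sup (range (fun x => normc (f x))).

Lemma cfun_cts f : continuous f.
Proof. exact: (@cts_fun _ _ (f : continuousType X C)). Qed.

Lemma cfunP f g : f =1 g -> f = g.
Proof. by move=> fg; exact/(@continuousEP X C f g). Qed.

Lemma supnorm_ub (f : X -> C) : continuous f ->
  has_ubound (range (fun x => normc (f x))).
Proof.
move=> cf; have [[x0 _]|X0] := pselect ([set: X] !=set0); last first.
  by exists 0 => z [x _ _]; exfalso; apply: X0; exists x.
have cn : continuous (fun x => normc (f x)).
  move=> x; apply/cvgrPdist_lt => e e0; have /ccvgP/(_ _ e0) := cf x.
  apply: filterS => y; apply: le_lt_trans.
  have /= := le_normcD (f x - f y) (f y); rewrite subrK => xy.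
  have /= := le_normcD (f y - f x) (f x); rewrite subrK normcB => yx.
  by rewrite ler_norml lerBlDr xy andbT lerNl opprB lerBlDr.
have [] := @compact_EVT_max X R (fun x => normc (f x)) setT _ cX.
- by exists x0.
- exact: continuous_subspaceT.
move=> c _ cmax; exists (normc (f c)) => z [x _ <-].
by apply: cmax; rewrite inE.
Qed.

Lemma supnorm_ge (f : X -> C) x : continuous f -> normc (f x) <= supnorm f.
Proof. by move=> cf; apply: ub_le_sup; [exact: supnorm_ub|exists x]. Qed.

Lemma supnorm_le (f : X -> C) r :
  0 <= r -> (forall x, normc (f x) <= r) -> supnorm f <= r.
Proof.
move=> r0 fr; have [[x0 _]|X0] := pselect ([set: X] !=set0).
  by apply: ge_sup; [exists (normc (f x0)), x0|move=> _ [x _ <-]].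
rewrite /supnorm (_ : range (fun x => normc (f x)) = set0) ?sup0//.
by rewrite -subset0 => z [x _ _]; apply: X0; exists x.
Qed.

Lemma supnorm_ge0 (f : X -> C) : 0 <= supnorm f.
Proof.
have [H|H] := pselect (has_sup (range (fun x => normc (f x)))); last first.
  by rewrite /supnorm sup_out.
case: H => -[z [x _ _]] ub.
by apply: le_trans (normc_ge0 (f x)) (ub_le_sup ub _); exists x.
Qed.

Definition cdist f g : R := supnorm (fun x => f x - g x).

Lemma sub_cts (f g : X -> C) : continuous f -> continuous g ->
  continuous (fun x => f x - g x).
Proof. by move=> cf cg x; apply: cvgB; [exact: cf|exact: cg]. Qed.

Lemma cdist_ge f g x : normc (f x - g x) <= cdist f g.
Proof.
by apply: (@supnorm_ge (fun x => f x - g x)); apply: sub_cts; exact: cfun_cts.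
Qed.

Lemma cdist_le f g r :
  0 <= r -> (forall x, normc (f x - g x) <= r) -> cdist f g <= r.
Proof. exact: supnorm_le. Qed.

Lemma cdist_ge0 f g : 0 <= cdist f g. Proof. exact: supnorm_ge0. Qed.

Lemma cdistxx f : cdist f f = 0.
Proof.
apply/eqP; rewrite eq_le cdist_ge0 andbT; apply: cdist_le => // x.
by rewrite subrr normc0.
Qed.

Lemma cdist_positivity f g : cdist f g = 0 -> f = g.
Proof.
move=> fg0; apply: cfunP => x; apply/eqP; rewrite -subr_eq0; apply/eqP.
apply: eq0_normc; apply/eqP; rewrite eq_le normc_ge0 andbT -fg0.
exact: cdist_ge.
Qed.

Lemma cdist_sym f g : cdist f g = cdist g f.
Proof.
have H (f' g' : CX) : cdist f' g' <= cdist g' f'.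
  apply: cdist_le; [exact: cdist_ge0|move=> x].
  by rewrite normcB; exact: cdist_ge.
by apply/eqP; rewrite eq_le !H.
Qed.

Lemma cdist_triangle g f h : cdist f h <= cdist f g + cdist g h.
Proof.
apply: cdist_le => [|x]; first by rewrite addr_ge0// cdist_ge0.
by rewrite (le_trans (normc_triangle (g x) _ _))// lerD// cdist_ge.
Qed.

HB.instance Definition _ := @isMetric.Build R CX
  cdist cdistxx cdist_positivity cdist_sym cdist_triangle.

Definition cball (n : nat) : set CX := [set f | supnorm f <= n%:R].

Lemma cst_cts (c : C) : continuous (fun _ : X => c).
Proof. by move=> x; exact: cvg_cst. Qed.

Lemma add_cts f g : continuous (fun x => f x + g x).
Proof. by move=> x; apply: cvgD; exact: cfun_cts. Qed.

Lemma mul_cts f g : continuous (fun x => f x * g x).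
Proof. by move=> x; apply: cvgM; exact: cfun_cts. Qed.

Lemma scale_cts (l : C) f : continuous (fun x => l * f x).
Proof. by move=> x; apply: cvgM; [exact: cvg_cst|exact: cfun_cts]. Qed.

Lemma conj_cts f : continuous (fun x => (f x)^* : C).
Proof.
move=> x; apply/ccvgP => e e0; have /ccvgP/(_ _ e0) := @cfun_cts f x.
by apply: filterS => y; rewrite -rmorphB normc_conj.
Qed.

Lemma comp_cts (S : continuousType X X) f : continuous (fun x => f (S x)).
Proof.
by move=> x; apply: continuous_comp; [exact: cts_fun|exact: cfun_cts].
Qed.

Lemma cball_complete n (u : nat -> CX) : (forall k, cball n (u k)) ->
  cauchy (u @ \oo) -> exists2 f : CX, cball n f & u @ \oo --> f.
Proof.
move=> un /cauchy_ballP uC.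
have {}uC (e : R) : 0 < e -> exists N, forall i j, (N <= i)%N -> (N <= j)%N ->
    cdist (u i) (u j) < e.
  move=> e0; have [[A B] /= [[N1 _ hA] [N2 _ hB]] AB] := uC _ e0.
  exists (maxn N1 N2) => i j; rewrite !geq_max => /andP[i1 i2] /andP[j1 j2].
  have := AB (u i, u j); rewrite /= ballEmdist /=; apply.
  by split; [exact: hA|exact: hB].
have uP x : exists l : R[i],
    forall e : R, 0 < e -> \forall k \near \oo, normc (u k x - l) < e.
  apply: cauchy_normc_cvg => e /uC[N HN]; exists N => i j Ni Nj.
  exact: le_lt_trans (cdist_ge _ _ _) (HN _ _ Ni Nj).
have [f fP] := choice uP.
have uf (e : R) : 0 < e -> exists N, forall i, (N <= i)%N ->
    forall x, normc (u i x - f x) <= e.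
  move=> /uC[N HN]; exists N => i Ni x; apply/ler_addgt0Pr => d d0.
  have [j [Nj jd]] : exists j, (N <= j)%N /\ normc (u j x - f x) < d.
    have [M _ HM] := fP x _ d0.
    exists (maxn M N); split; first exact: leq_maxr.
    by apply: HM; rewrite /= leq_maxl.
  apply: le_trans (normc_triangle (u j x) _ _) _.
  apply: lerD (ltW jd).
  exact: le_trans (cdist_ge _ _ _) (ltW (HN _ _ Ni Nj)).
have cf : continuous (f : X -> C).
  move=> x; apply/ccvgP => e e0.
  have e30 : 0 < e / 3 by rewrite divr_gt0.
  have [N /(_ _ (leqnn N)) HN] := uf _ e30.
  have /ccvgP/(_ _ e30) := @cfun_cts (u N) x.
  apply: filterS => y uxy.
  apply: le_lt_trans (normc_triangle (u N x) _ _) _.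
  have -> : e = e / 3 + (e / 3 + e / 3) by field.
  rewrite ler_ltD//; first by rewrite normcB.
  by apply: le_lt_trans (normc_triangle (u N y) _ _) _; rewrite ltr_leD.
exists (mk_cfun cf).
  apply: supnorm_le => // x; apply/ler_addgt0Pr => d /uf[N /(_ _ (leqnn N)) HN].
  have := le_normcD (f x - u N x) (u N x); rewrite subrK => /le_trans; apply.
  rewrite addrC; apply: lerD; last by rewrite normcB.
  exact: le_trans (supnorm_ge _ (@cfun_cts _)) (un N).
apply/metricType_numDomainType.cvgrPdist_lt => e e0.
have e20 : 0 < e / 2 by rewrite divr_gt0.
have [N HN] := uf _ e20; exists N => // k /= Nk.
apply: (@le_lt_trans _ _ (e / 2)); last by rewrite ltr_pdivrMr// ltr_pMr ?ltr1n.
by apply: cdist_le => [|x]; [exact: ltW|rewrite normcB; exact: HN].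
Qed.

Lemma cball_cover f : exists n, cball n f.
Proof.
exists (Num.bound (supnorm f)).
by have := archi_boundP (supnorm_ge0 f) => /ltW.
Qed.

Lemma cball_ge n f x : cball n f -> normc (f x) <= n%:R.
Proof. exact/le_trans/supnorm_ge/cfun_cts. Qed.

Lemma cball_bounded n f g : cball n f -> cball n g -> cdist f g <= (2 * n)%N%:R.
Proof.
move=> fn gn; apply: cdist_le => // x; rewrite mul2n -addnn natrD.
apply: le_trans (le_normcD _ _) _.
by rewrite normcN lerD// cball_ge.
Qed.

Definition zero_cfun : CX := mk_cfun (@cst_cts 0).
Definition one_cfun : CX := mk_cfun (@cst_cts 1).
Definition add_cfun f g : CX := mk_cfun (@add_cts f g).
Definition mul_cfun f g : CX := mk_cfun (@mul_cts f g).
Definition conj_cfun f : CX := mk_cfun (@conj_cts f).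
Definition scale_cfun (l : R[i]) f : CX := mk_cfun (@scale_cts l f).
Definition comp_cfun (S : continuousType X X) f : CX := mk_cfun (@comp_cts S f).

Lemma cball_zero : cball 0 zero_cfun.
Proof. by apply: supnorm_le => // x; rewrite normc0. Qed.

Lemma cball_one : cball 1 one_cfun.
Proof. by apply: supnorm_le => // x; rewrite normc1. Qed.

Lemma cball_add m n f g : cball m f -> cball n g -> cball (m + n) (add_cfun f g).
Proof.
move=> fm gn; apply: supnorm_le => // x; rewrite natrD.
by apply: le_trans (le_normcD _ _) _; rewrite lerD// cball_ge.
Qed.

Lemma cball_mul m n f g : cball m f -> cball n g -> cball (m * n) (mul_cfun f g).
Proof.
move=> fm gn; apply: supnorm_le => // x.
by rewrite natrM normcM ler_pM ?normc_ge0// cball_ge.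
Qed.

Lemma cball_conj n f : cball n f -> cball n (conj_cfun f).
Proof. by move=> fn; apply: supnorm_le => // x; rewrite normc_conj cball_ge. Qed.

Lemma cball_scale m n (l : R[i]) f :
  normc l * m%:R <= n%:R -> cball m f -> cball n (scale_cfun l f).
Proof.
move=> lmn fm; apply: supnorm_le => // x; rewrite normcM.
by apply: le_trans lmn; rewrite ler_wpM2l ?normc_ge0// cball_ge.
Qed.

Lemma cball_comp S n f : cball n f -> cball n (comp_cfun S f).
Proof. by move=> fn; apply: supnorm_le => // x; apply: (cball_ge (S x)). Qed.

Lemma cdist_add m n f f' g g' :
  cball m f -> cball m f' -> cball n g -> cball n g' ->
  cdist (add_cfun f g) (add_cfun f' g') <= cdist f f' + cdist g g'.
Proof.
move=> _ _ _ _; apply: cdist_le => [|x]; first by rewrite addr_ge0// cdist_ge0.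
rewrite (_ : _ - _ = (f x - f' x) + (g x - g' x)); last by rewrite opprD addrACA.
by apply: le_trans (le_normcD _ _) _; rewrite lerD// cdist_ge.
Qed.

Lemma cdist_mul m n f f' g g' :
  cball m f -> cball m f' -> cball n g -> cball n g' ->
  cdist (mul_cfun f g) (mul_cfun f' g') <=
  n%:R * cdist f f' + m%:R * cdist g g'.
Proof.
move=> fm fm' gn gn'; apply: cdist_le => [|x].
  by rewrite addr_ge0// mulr_ge0// cdist_ge0.
rewrite (_ : _ - _ = g x * (f x - f' x) + f' x * (g x - g' x)); last first.
  by rewrite !mulrBr addrA [g x * f x]mulrC [g x * f' x]mulrC subrK.
apply: le_trans (le_normcD _ _) _; rewrite !normcM.
by rewrite lerD// ler_pM ?normc_ge0 ?cdist_ge// cball_ge.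
Qed.

Lemma cdist_conj n f g : cball n f -> cball n g ->
  cdist (conj_cfun f) (conj_cfun g) <= cdist f g.
Proof.
move=> _ _; apply: cdist_le => [|x]; first exact: cdist_ge0.
by rewrite -rmorphB normc_conj cdist_ge.
Qed.

Lemma cdist_scale n (l : R[i]) f g : cball n f -> cball n g ->
  cdist (scale_cfun l f) (scale_cfun l g) <= normc l * cdist f g.
Proof.
move=> _ _; apply: cdist_le => [|x].
  by rewrite mulr_ge0 ?normc_ge0 ?cdist_ge0.
by rewrite -mulrBr normcM ler_wpM2l ?normc_ge0// cdist_ge.
Qed.

Lemma cdist_comp S n f g : cball n f -> cball n g ->
  cdist (comp_cfun S f) (comp_cfun S g) <= cdist f g.
Proof.
move=> _ _; apply: cdist_le => [|x]; first exact: cdist_ge0.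
exact: (cdist_ge _ _ (S x)).
Qed.

Definition cfun_structure (S : continuousType X X) : structure R :=
  @Structure R CX cball zero_cfun one_cfun add_cfun mul_cfun conj_cfun
    scale_cfun (comp_cfun S) cball_cover cball_bounded cball_complete
    cball_zero cball_one cball_add cball_mul cball_conj cball_scale
    (@cball_comp S) cdist_add cdist_mul cdist_conj cdist_scale (@cdist_comp S).

End ContinuousFunctions.

Definition homeomorphism (X Y : topologicalType) (h : X -> Y) : Prop :=
  continuous h /\
  exists g : Y -> X, [/\ continuous g, cancel h g & cancel g h].

Definition conjugate (X Y : topologicalType) (S : X -> X) (S' : Y -> Y) : Prop :=
  exists2 h : X -> Y, homeomorphism h & h \o S =1 S' \o h.

Section AddingMachine.
Variables (a : nat -> nat) (a_ge2 : forall n, (2 <= a n)%N).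

Definition odometer_space : topologicalType :=
  prod_topology (fun n => discrete_topology 'I_(a n)).

Definition digit (b : odometer_space) (n : nat) : 'I_(a n) := b n.

Definition zero_digit (n : nat) : 'I_(a n) := Ordinal (ltnW (a_ge2 n)).

(* [insubd] does not use its default value here, as the digit to be increased is
   not maximal. *)
Definition adding_machine (b : odometer_space) : odometer_space :=
  match pselect (exists n, (digit b n < a n - 1)%N) with
  | left ex =>
      let n := ex_minn ex in
      fun k => if (k < n)%N then zero_digit k
               else if k == n then insubd (zero_digit k) (digit b k).+1
               else digit b k
  | right _ => zero_digit
  end.

End AddingMachine.

Definition odometer (X : topologicalType) (S : X -> X) : Prop :=
  exists (a : nat -> nat) (a_ge2 : forall n, (2 <= a n)%N),
    conjugate (@adding_machine a a_ge2) S.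

(* The structures [(C(X), f |-> f \o S)] for [X] the Cantor set and [S] a
   homeomorphism of [X] which is an odometer. *)
Definition cantor_odometer_structure (R : realType) (M : structure R) : Prop :=
  exists S : continuousType cantor_space cantor_space,
    [/\ homeomorphism S, odometer S &
        M = cfun_structure R cantor_space_compact S].

(* Main.v *)
(* Continuous logic cannot exclude functions without almost periods.  In an
   odometer every continuous [f] is uniformly close to a function of finitely
   many coordinates, on which the odometer acts as a permutation of a finite set;
   hence [|sigma^n f - f| < 1] for some [n > 0].  On the other hand, in
   [A = C(2^N)] with the binary odometer, the indicator function of [k] initial
   zeros has [|sigma^n f - f| >= 1] for [0 < n <= k].  The class of this sequence
   in an ultrapower of [A] satisfies this for all [n > 0], and a separable
   elementary substructure containing it is a separable model of the theory of
   [A] which is not the structure of an odometer.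

   The language is uncountable, because of the scalars and of the connectives.
   The Lowenheim-Skolem argument thus uses a countable set of formulas, with
   rational scalars and the connectives of lattice-ordered rational vector
   spaces, which are uniformly dense among all formulas on the structures
   concerned. *)
Require Import Defs.
From HB Require Import structures.
From mathcomp Require Import all_boot all_order all_algebra.
From mathcomp Require Import all_classical all_reals all_analysis.
From mathcomp Require Import fingroup perm generic_quotient complex ring lra zify.

Set Implicit Arguments.
Unset Strict Implicit.
Unset Printing Implicit Defensive.

Import Order.TTheory GRing.Theory Num.Theory Normc.
Import numFieldNormedType.Exports.

Local Open Scope classical_set_scope.
Local Open Scope ring_scope.
Local Open Scope complex_scope.

(** * Countably many formulas *)

(** A structure carries no C*-axioms, so a separable model of the theory is not known to be any
    [C(X)], and it never has to be recognised as one: the assumed theory itself supplies an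
    isomorphism with an odometer structure, of which only the compatibility with distances and with
    [sigma] is used. What the approximation of formulas requires beyond the axioms of a structure is
    isolated in [tame], which holds for the structures of continuous functions and passes to
    ultrapowers and to hulls. Constants attached to a formula must not depend on the structure,
    since one approximating formula has to serve the Cantor structure and its extension at once, and
    one bound has to serve all coordinates of an ultrapower. The contradiction is between the bounds
    1 and 1/2: being at distance at least 1 is a closed condition, so it survives limits along an
    ultrafilter, and isometries preserve it exactly. *)

Inductive cterm :=
| CVar of nat
| CZero
| COne
| CAdd of cterm & cterm
| CMul of cterm & cterm
| CStar of cterm
| CScale of rat * rat & cterm
| CSigma of cterm.

Inductive cform :=
| CDist of cterm & cterm
| CConst of rat
| CPlus of cform & cform
| CMax of cform & cform
| CTimes of rat & cform
| CSup of nat & cform.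

(** Labels are reused: the number of children separates the constructors. Among childless nodes 0
    and 1 stand for the constants, so variables start at label 2. *)
Fixpoint cterm_tree t : GenTree.tree (rat * rat) :=
  match t with
  | CVar n => GenTree.Node n.+2 [::]
  | CZero => GenTree.Node 0 [::]
  | COne => GenTree.Node 1 [::]
  | CAdd t u => GenTree.Node 0 [:: cterm_tree t; cterm_tree u]
  | CMul t u => GenTree.Node 1 [:: cterm_tree t; cterm_tree u]
  | CStar t => GenTree.Node 0 [:: cterm_tree t]
  | CSigma t => GenTree.Node 1 [:: cterm_tree t]
  | CScale q t => GenTree.Node 2 [:: GenTree.Leaf q; cterm_tree t]
  end.

Fixpoint tree_cterm (t : GenTree.tree (rat * rat)) : cterm :=
  match t with
  | GenTree.Node n.+2 [::] => CVar n
  | GenTree.Node 1 [::] => COne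
  | GenTree.Node 0 [:: t; u] => CAdd (tree_cterm t) (tree_cterm u)
  | GenTree.Node 1 [:: t; u] => CMul (tree_cterm t) (tree_cterm u)
  | GenTree.Node 0 [:: t] => CStar (tree_cterm t)
  | GenTree.Node 1 [:: t] => CSigma (tree_cterm t)
  | GenTree.Node 2 [:: GenTree.Leaf q; t] => CScale q (tree_cterm t)
  | _ => CZero
  end.

Lemma cterm_treeK : cancel cterm_tree tree_cterm.
Proof. by elim=> [[]||| /= t -> u ->|/= t -> u ->|/= t ->|/= q t ->|/= t ->]. Qed.

HB.instance Definition _ := Countable.copy cterm (can_type cterm_treeK).

Fixpoint cform_tree f : GenTree.tree (rat + (cterm * cterm)) :=
  match f with
  | CDist t u => GenTree.Leaf (inr (t, u))
  | CConst q => GenTree.Leaf (inl q)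
  | CPlus f g => GenTree.Node 0 [:: cform_tree f; cform_tree g]
  | CMax f g => GenTree.Node 1 [:: cform_tree f; cform_tree g]
  | CTimes q f => GenTree.Node 2 [:: GenTree.Leaf (inl q); cform_tree f]
  | CSup m f => GenTree.Node m [:: cform_tree f]
  end.

Fixpoint tree_cform (t : GenTree.tree (rat + (cterm * cterm))) : cform :=
  match t with
  | GenTree.Leaf (inr (t, u)) => CDist t u
  | GenTree.Leaf (inl q) => CConst q
  | GenTree.Node 0 [:: f; g] => CPlus (tree_cform f) (tree_cform g)
  | GenTree.Node 1 [:: f; g] => CMax (tree_cform f) (tree_cform g)
  | GenTree.Node 2 [:: GenTree.Leaf (inl q); f] => CTimes q (tree_cform f)
  | GenTree.Node m [:: f] => CSup m (tree_cform f)
  | _ => CConst 0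
  end.

Lemma cform_treeK : cancel cform_tree tree_cform.
Proof.
elim=> //= [f -> g ->|f -> g ->|q f ->|m f fK] //.
(* For label 2 the match inspects the first child, looking for a rational leaf, before it counts the
   children; hence the case split on [cform_tree f]. *)
by rewrite -[in RHS]fK; case: m => [|[|[|m]]] //; case: (cform_tree f) => [[]|].
Qed.

HB.instance Definition _ := Countable.copy cform (can_type cform_treeK).

Section SupFacts.
Variables (R : realType) (T : Type) (A : set T).
Implicit Types F G : T -> R.

Lemma has_sup_bounded F B : A !=set0 -> (forall x, A x -> `|F x| <= B) ->
  has_sup [set F x | x in A].
Proof.
move=> [a Aa] FB; split; first by exists (F a), a.
by exists B => _ [x Ax <-]; exact: le_trans (ler_norm _) (FB _ Ax).
Qed.

Lemma norm_sup_le F B : A !=set0 -> (forall x, A x -> `|F x| <= B) ->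
  `|sup [set F x | x in A]| <= B.
Proof.
move=> A0 FB; have [n0 ub] := has_sup_bounded A0 FB.
rewrite ler_norml; apply/andP; split.
  have [a Aa] := A0; apply: (@le_trans _ _ (F a)).
    by have := FB _ Aa; rewrite ler_norml => /andP[].
  by apply: ub_le_sup => //; exists a.
by apply: ge_sup => // _ [x Ax <-]; exact: le_trans (ler_norm _) (FB _ Ax).
Qed.

(** Taking a supremum is 1-Lipschitz for the uniform distance. The bounds keep [sup] away from its
    default value on unbounded sets. *)
Lemma dist_sup_le F G B c : A !=set0 -> (forall x, A x -> `|F x| <= B) ->
  (forall x, A x -> `|G x| <= B) -> (forall x, A x -> `|F x - G x| <= c) ->
  `|sup [set F x | x in A] - sup [set G x | x in A]| <= c.
Proof.
move=> A0; wlog suff : F G / (forall x, A x -> `|F x| <= B) ->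
  (forall x, A x -> `|G x| <= B) -> (forall x, A x -> `|F x - G x| <= c) ->
  sup [set F x | x in A] - sup [set G x | x in A] <= c.
  move=> H FB GB FG; rewrite ler_norml; apply/andP; split; last exact: H.
  by rewrite lerNl opprB; apply: H => // x Ax; rewrite distrC FG.
move=> FB GB FG; have [n0 _] := has_sup_bounded A0 FB.
rewrite lerBlDl; apply: ge_sup => // _ [x Ax <-].
have := FG _ Ax; rewrite ler_norml => /andP[_]; rewrite lerBlDl => /le_trans.
apply; rewrite lerD2r; apply: ub_le_sup; last by exists x.
by have [] := has_sup_bounded A0 GB.
Qed.

Lemma sup_opp_inf F : inf [set F x | x in A] = - sup [set - F x | x in A].
Proof. by rewrite /inf image_comp. Qed.

End SupFacts.

Definition rat_scalar (R : realType) (q : rat * rat) : R[i] :=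
  ratr q.1 +i* ratr q.2.

Section CountableSemantics.
Variables (R : realType) (M : structure R).
Implicit Types s : seq M.

(** Variables are de Bruijn indices into a list that is read as an infinite sequence ending in
    zeros. Formulas thus form one countable type without an arity, and a quantifier pushes its
    element onto the list. *)
Fixpoint cterm_val s t : M :=
  match t with
  | CVar n => nth (op_zero M) s n
  | CZero => op_zero M
  | COne => op_one M
  | CAdd t u => op_add (cterm_val s t) (cterm_val s u)
  | CMul t u => op_mul (cterm_val s t) (cterm_val s u)
  | CStar t => op_star (cterm_val s t)
  | CScale q t => op_scale (rat_scalar R q) (cterm_val s t)
  | CSigma t => op_sigma (cterm_val s t)
  end.

Fixpoint cform_val s f : R :=
  match f with
  | CDist t u => mdist (cterm_val s t) (cterm_val s u)
  | CConst q => ratr q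
  | CPlus f g => cform_val s f + cform_val s g
  | CMax f g => Num.max (cform_val s f) (cform_val s g)
  | CTimes q f => ratr q * cform_val s f
  | CSup m f => sup [set cform_val (x :: s) f | x in dom m]
  end.

(* The C*-algebraic facts not part of the definition of a structure that make
   formulas uniformly approximable by countably many ones. *)
Definition tame := (forall n (x : M), dom n x -> dom n.+1 x) /\
  (forall n l l' (x : M), dom n x ->
    mdist (op_scale l x) (op_scale l' x) <= normc (l - l') * n%:R).

Definition env_dom n s := forall i, dom n (nth (op_zero M) s i).

Definition env_close d s s' :=
  forall i, mdist (nth (op_zero M) s i) (nth (op_zero M) s' i) <= d.

Lemma tame_dom m n x : tame -> (m <= n)%N -> dom m x -> dom n (x : M).
Proof.
move=> [T _] /subnKC <-; elim: (n - m)%N => [|k IH]; rewrite ?addn0// addnS.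
by move=> /IH; exact: T.
Qed.

Lemma tame_dom0 n : tame -> dom n (op_zero M).
Proof. by move=> T; apply: (tame_dom T (leq0n n)); exact: dom_zero. Qed.

Lemma env_dom_cons m n x s : tame -> dom m x -> env_dom n s ->
  env_dom (maxn m n) (x :: s).
Proof.
move=> T mx sn [|i] /=; first by apply: tame_dom mx; rewrite ?leq_maxl.
by apply: tame_dom (sn i); rewrite ?leq_maxr.
Qed.

Lemma env_dom_nil n : tame -> env_dom n [::].
Proof. by move=> T i; rewrite nth_nil; exact: tame_dom0. Qed.

Lemma env_close_cons d x s s' : 0 <= d -> env_close d s s' ->
  env_close d (x :: s) (x :: s').
Proof. by move=> d0 ss' [|i] /=; rewrite ?mdistxx. Qed.

End CountableSemantics.

Lemma natr_ge (R : realType) (x : R) : exists n : nat, x <= n%:R.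
Proof.
exists (Num.bound `|x|); apply: le_trans (ler_norm _) _.
exact: ltW (archi_boundP _).
Qed.

(** * Bounds and Lipschitz constants uniform in the structure *)

Section UniformBounds.
Variable R : realType.
Implicit Type M : structure R.

Lemma cterm_dom L t : exists B, forall M (s : seq M), tame M ->
  env_dom L s -> dom B (cterm_val s t).
Proof.
elim: t => /= [n|||t [B tB] u [C uC]|t [B tB] u [C uC]|t [B tB]|q t [B tB]|t [B tB]].
- by exists L => M s _; apply.
- by exists 0%N => M s _ _; exact: dom_zero.
- by exists 1%N => M s _ _; exact: dom_one.
- exists (B + C)%N => M s T sL; apply: dom_add; [exact: tB|exact: uC].
- exists (B * C)%N => M s T sL; apply: dom_mul; [exact: tB|exact: uC].
- by exists B => M s T sL; apply: dom_star; exact: tB.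
- have [n Hn] := natr_ge (normc (rat_scalar R q) * B%:R).
  by exists n => M s T sL; apply: dom_scale Hn _; exact: tB.
- by exists B => M s T sL; apply: dom_sigma; exact: tB.
Qed.

Lemma cterm_lipschitz L t : exists K : nat, forall M (s s' : seq M) d, tame M ->
  0 <= d -> env_dom L s -> env_dom L s' -> env_close d s s' ->
  mdist (cterm_val s t) (cterm_val s' t) <= K%:R * d.
Proof.
elim: t => /= [n|||t [K Ht] u [K' Hu]|t [K Ht] u [K' Hu]|t [K Ht]|q t [K Ht]|t [K Ht]].
- by exists 1%N => M s s' d _ _ _ _ ss'; rewrite mul1r.
- by exists 0%N => M s s' d *; rewrite mdistxx mul0r.
- by exists 0%N => M s s' d *; rewrite mdistxx mul0r.
- have [B HB] := cterm_dom L t; have [C HC] := cterm_dom L u.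
  exists (K + K')%N => M s s' d T d0 sL s'L ss'; rewrite natrD mulrDl.
  apply: le_trans (mod_add (HB _ _ T sL) (HB _ _ T s'L) (HC _ _ T sL) (HC _ _ T s'L)) _.
  by rewrite lerD ?Ht ?Hu.
- have [B HB] := cterm_dom L t; have [C HC] := cterm_dom L u.
  exists (C * K + B * K')%N => M s s' d T d0 sL s'L ss'; rewrite natrD mulrDl.
  apply: le_trans (mod_mul (HB _ _ T sL) (HB _ _ T s'L) (HC _ _ T sL) (HC _ _ T s'L)) _.
  by rewrite !natrM -!mulrA lerD ?ler_wpM2l ?Ht ?Hu.
- have [B HB] := cterm_dom L t; exists K => M s s' d T d0 sL s'L ss'.
  by apply: le_trans (mod_star (HB _ _ T sL) (HB _ _ T s'L)) _; rewrite Ht.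
- have [B HB] := cterm_dom L t; have [n Hn] := natr_ge (normc (rat_scalar R q)).
  exists (n * K)%N => M s s' d T d0 sL s'L ss'.
  apply: le_trans (mod_scale _ (HB _ _ T sL) (HB _ _ T s'L)) _.
  by rewrite natrM -mulrA ler_pM ?normc_ge0 ?mdist_ge0 ?Ht.
- have [B HB] := cterm_dom L t; exists K => M s s' d T d0 sL s'L ss'.
  by apply: le_trans (mod_sigma (HB _ _ T sL) (HB _ _ T s'L)) _; rewrite Ht.
Qed.

(** Gives meaning to the suprema in formulas. Since [B] precedes [M], the same bound applies to a
    structure, to its ultrapower and to every coordinate of a bounded sequence. *)
Lemma cform_bounded f L : exists B : nat, forall M (s : seq M), tame M ->
  env_dom L s -> `|cform_val s f| <= B%:R.
Proof.
elim: f L => /= [t u|q|f IHf g IHg|f IHf g IHg|q f IHf|m f IHf] L.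
- have [B HB] := cterm_dom L t; have [C HC] := cterm_dom L u.
  exists (2 * maxn B C)%N => M s T sL; rewrite ger0_norm ?mdist_ge0//.
  apply: dom_bounded.
    by apply: tame_dom (HB _ _ T sL); rewrite ?leq_maxl.
  by apply: tame_dom (HC _ _ T sL); rewrite ?leq_maxr.
- by have [n Hn] := natr_ge `|ratr q : R|; exists n.
- have [B HB] := IHf L; have [C HC] := IHg L; exists (B + C)%N => M s T sL.
  by rewrite natrD (le_trans (ler_normD _ _))// lerD ?HB ?HC.
- have [B HB] := IHf L; have [C HC] := IHg L; exists (maxn B C)%N => M s T sL.
  rewrite /Num.max; case: ifP => _.
    by apply: le_trans (HC _ _ T sL) _; rewrite ler_nat leq_maxr.
  by apply: le_trans (HB _ _ T sL) _; rewrite ler_nat leq_maxl.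
- have [B HB] := IHf L; have [n Hn] := natr_ge `|ratr q : R|.
  by exists (n * B)%N => M s T sL; rewrite normrM natrM ler_pM ?HB.
- have [B HB] := IHf (maxn m L); exists B => M s T sL; apply: norm_sup_le.
    by exists (op_zero M); exact: tame_dom0.
  by move=> x mx; apply: HB => //; exact: env_dom_cons.
Qed.

Lemma dist_max_le (a b a' b' c : R) : `|a - a'| <= c -> `|b - b'| <= c ->
  `|Num.max a b - Num.max a' b'| <= c.
Proof.
rewrite !ler_norml => /andP[a1 a2] /andP[b1 b2].
case: (leP a b) => ab; case: (leP a' b') => ab'; apply/andP; split; lra.
Qed.

(** Serves to replace parameters of a formula by nearby members of a countable family, at a cost
    known before the distance [d] is chosen. *)
Lemma cform_lipschitz f L : exists K : nat, forall M (s s' : seq M) d, tame M ->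
  0 <= d -> env_dom L s -> env_dom L s' -> env_close d s s' ->
  `|cform_val s f - cform_val s' f| <= K%:R * d.
Proof.
elim: f L => /= [t u|q|f IHf g IHg|f IHf g IHg|q f IHf|m f IHf] L.
- have [B HB] := cterm_lipschitz L t; have [C HC] := cterm_lipschitz L u.
  exists (B + C)%N => M s s' d T d0 sL s'L ss'; rewrite natrD mulrDl.
  have := HB _ _ _ _ T d0 sL s'L ss'; have := HC _ _ _ _ T d0 sL s'L ss'.
  set x := cterm_val s t; set y := cterm_val s u.
  set x' := cterm_val s' t; set y' := cterm_val s' u => yy xx.
  have h1 := metric_triangle x x' y; have h2 := metric_triangle x' y' y.
  have h3 := metric_triangle x' x y'; have h4 := metric_triangle x y y'.
  have h5 := metric_sym x x'; have h6 := metric_sym y y'.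
  by rewrite ler_norml; apply/andP; split; lra.
- by exists 0%N => M s s' d *; rewrite subrr normr0 mul0r.
- have [B HB] := IHf L; have [C HC] := IHg L.
  exists (B + C)%N => M s s' d T d0 sL s'L ss'; rewrite natrD mulrDl.
  by rewrite opprD addrACA (le_trans (ler_normD _ _))// lerD ?HB ?HC.
- have [B HB] := IHf L; have [C HC] := IHg L.
  exists (maxn B C)%N => M s s' d T d0 sL s'L ss'; apply: dist_max_le.
    by apply: le_trans (HB _ _ _ _ T d0 sL s'L ss') _; rewrite ler_wpM2r// ler_nat leq_maxl.
  by apply: le_trans (HC _ _ _ _ T d0 sL s'L ss') _; rewrite ler_wpM2r// ler_nat leq_maxr.
- have [B HB] := IHf L; have [n Hn] := natr_ge `|ratr q : R|.
  exists (n * B)%N => M s s' d T d0 sL s'L ss'.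
  by rewrite -mulrBr normrM natrM -mulrA ler_pM ?HB.
- have [B HB] := IHf (maxn m L); have [C HC] := cform_bounded f (maxn m L).
  exists B => M s s' d T d0 sL s'L ss'; apply: (@dist_sup_le _ _ _ _ _ C%:R).
  + by exists (op_zero M); exact: tame_dom0.
  + by move=> x mx; apply: HC => //; exact: env_dom_cons.
  + by move=> x mx; apply: HC => //; exact: env_dom_cons.
  + move=> x mx; apply: HB => //; [exact: env_dom_cons..|exact: env_close_cons].
Qed.

End UniformBounds.

(** * Approximation of formulas *)

Lemma rat_toward_zero (R : realType) (x e : R) : 0 < e ->
  exists q : rat, `|ratr q| <= `|x| /\ `|x - ratr q| <= e.
Proof.
wlog x0 : x / 0 <= x => [H|] e0.
  have [/H/(_ e0)//|x0] := leP 0 x.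
  have [|q [q1 q2]] := H (- x) _ e0; first by rewrite oppr_ge0 ltW.
  exists (- q); rewrite rmorphN normrN -(normrN x); split=> //.
  by rewrite opprK -normrN opprD.
have [->|xn0] := eqVneq x 0.
  by exists 0; rewrite rmorph0 subr0 normr0 lexx ltW.
have [q] : exists q, ratr q \in `]Num.max 0 (x - e), x[.
  by apply: rat_in_itvoo; rewrite gt_max lt_neqAle eq_sym xn0 x0/= gtrBl.
rewrite in_itv /= gt_max => /andP[/andP[q0 qe] qx]; exists q.
rewrite !ger0_norm ?subr_ge0 ?(ltW qx) ?(ltW q0)//; split=> //; lra.
Qed.

(** Rounding must not increase the modulus: then [dom_scale] puts the exact and the rounded multiple
    of an element into the same domain. *)
Lemma rat_scalar_toward_zero (R : realType) (l : R[i]) (e : R) : 0 < e ->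
  exists q : rat * rat, normc (rat_scalar R q) <= normc l /\
    normc (l - rat_scalar R q) <= e.
Proof.
case: l => a b e0; have e20 : 0 < e / 2 by rewrite divr_gt0.
have [p [p1 p2]] := rat_toward_zero a e20.
have [q [q1 q2]] := rat_toward_zero b e20.
exists (p, q); split.
  rewrite /= ler_wsqrtr// lerD//.
  by rewrite -[leLHS]real_normK ?num_real// -[leRHS]real_normK ?num_real// lerXn2r ?nnegrE.
  by rewrite -[leLHS]real_normK ?num_real// -[leRHS]real_normK ?num_real// lerXn2r ?nnegrE.
by apply: le_trans (normc_le_ReIm _) _; rewrite (splitr e) lerD.
Qed.

Section Connectives.
Variable R : realType.
Implicit Types (M : structure R) (f : cform).

Definition cnorm f := CMax f (CTimes (-1) f).

Lemma cnorm_val M (s : seq M) f : cform_val s (cnorm f) = `|cform_val s f|.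
Proof. by rewrite /= rmorphN1 mulN1r maxrN.
Qed.

Definition csum I (r : seq I) (F : I -> cform) :=
  foldr CPlus (CConst 0) [seq F i | i <- r].

Lemma csum_val M (s : seq M) I (r : seq I) F :
  cform_val s (csum r F) = \sum_(i <- r) cform_val s (F i).
Proof.
elim: r => [|i r IH]; first by rewrite big_nil /= rmorph0.
by rewrite big_cons -IH.
Qed.

Definition cmax I (r : seq I) (F : I -> cform) f :=
  foldr CMax f [seq F i | i <- r].

Lemma cmax_val_ge M (s : seq M) (I : eqType) (r : seq I) F f i : i \in r ->
  cform_val s (F i) <= cform_val s (cmax r F f).
Proof.
elim: r => //= j r IH; rewrite inE le_max => /predU1P[->|/IH]; rewrite ?lexx//.
by move=> ->; rewrite orbT.
Qed.

Lemma cmax_val_le M (s : seq M) I (r : seq I) F f c : cform_val s f <= c ->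
  (forall i, cform_val s (F i) <= c) -> cform_val s (cmax r F f) <= c.
Proof. by move=> fc Fc; elim: r => //= i r IH; rewrite ge_max Fc. Qed.

Definition box k (B : R) : set 'rV[R]_k :=
  [set v : 'rV[R]_k | forall i, `|v 0 i| <= B].

Lemma box_compact k B : compact (@box k B).
Proof.
have := @rV_compact R k (fun=> [set` `[- B, B]]) (fun=> @segment_compact _ _ _).
congr compact; apply/seteqP; split=> v /= vB i; have := vB i;
  by rewrite /= in_itv /= ler_norml.
Qed.

(** Heine-Cantor: half of a radius good for [e / 2] at one point is good for [e] at all points
    nearby, and compactness, in the form of near coverings, yields a common [d]. *)
Lemma box_unif_continuous k B (u : 'rV[R]_k -> R) (e : R) : continuous u -> 0 < e ->
  exists2 d : R, 0 < d & forall v w : 'rV[R]_k, box B v -> (forall i, `|v 0 i - w 0 i| < d) ->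
    `|u v - u w| < e.
Proof.
move=> cu e0; have := @box_compact k B; move/compact_near_coveringP.
move=> /(_ _ (0^'+) (fun (d : R) (v : 'rV[R]_k) =>
  forall w : 'rV[R]_k, (forall i, `|v 0 i - w 0 i| < d) ->
  `|u v - u w| < e) _) [].
  move=> v _; have e20 : 0 < e / 2 by rewrite divr_gt0.
  have /cvgrPdist_lt/(_ _ e20)/nbhs_ballP[d /= d0 dP] := cu v.
  have d20 : 0 < d / 2 by rewrite divr_gt0.
  exists (ball v (d / 2), [set r | r < d / 2]).
    by split; [exact: nbhsx_ballx|exact: nbhs_right_lt].
  move=> [w r] /= [vw rd] z wz; rewrite (splitr e).
  apply: le_lt_trans (ler_distD (u v) _ _) _; rewrite ltrD//.
    rewrite distrC; apply: dP; apply: le_ball vw.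
    by rewrite ler_pdivrMr// ler_pMr// ler1n.
  apply: dP; rewrite (splitr d); apply: ball_triangle vw _.
  by split=> // i j; rewrite !ord1 /ball /=; exact: lt_trans (wz j) rd.
move=> d /= d0 H; exists (d / 2); first by rewrite divr_gt0.
move=> v w Bv vw; apply: (H (d / 2)) vw => //=.
  by rewrite sub0r normrN gtr0_norm ?divr_gt0// ltr_pdivrMr// ltr_pMr// ltr1n.
by rewrite divr_gt0.
Qed.

Lemma box_bounded k B (u : 'rV[R]_k -> R) : continuous u ->
  exists U : nat, forall v, box B v -> `|u v| <= U%:R.
Proof.
move=> cu; have := @box_compact k B; move/compact_near_coveringP.
move=> /(_ _ \oo (fun n v => `|u v| <= n%:R) _) [].
  move=> v _; have /cvgrPdist_lt/(_ _ ltr01) vP := cu v.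
  have [n Hn] := natr_ge (`|u v| + 1).
  exists ([set w | `|u v - u w| < 1], [set m | (n <= m)%N]).
    by split; [exact: vP|exists n].
  move=> [w m] /= [vw nm]; apply: (@le_trans _ _ n%:R); last by rewrite ler_nat.
  apply: le_trans Hn; rewrite -[u w](subrK (u v)) addrC.
  by rewrite (le_trans (ler_normD _ _))// lerD2l distrC ltW.
by move=> n _ /(_ n (leqnn n)); exists n.
Qed.

(* [u v] is the maximum over a fine rational grid of the functions
   [u g - Lam * |v - g|_1], up to a small error. *)
Lemma cform_connective k (u : 'rV[R]_k -> R) (B : nat) (e : R) : continuous u -> 0 < e ->
  exists2 d : R, 0 < d & exists Th : ('I_k -> cform) -> cform,
    forall M (s : seq M) (F : 'I_k -> cform) (v : 'rV[R]_k), box B%:R v ->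
      (forall i, `|v 0 i - cform_val s (F i)| <= d) ->
      `|u v - cform_val s (Th F)| <= e.
Proof.
move=> cu e0; have e40 : 0 < e / 4 by rewrite divr_gt0.
have [d0 d00 ud0] := box_unif_continuous B%:R cu e40.
have [U uU] := box_bounded B%:R cu.
(* A grid point at least [d0] away from [v] in some coordinate is at least [d0 / 2] away from the
   approximate arguments; with this [Lam] its penalty is at least [2 * U], which bounds the
   oscillation of [u] on the box. *)
have [Lam LamP] := natr_ge (4 * U%:R / d0).
(* The first bound makes twice the mesh [1 / N] smaller than [d0]; the second keeps the penalty of
   the grid point nearest to [v] below [e / 2], the remaining [e / 2] going to the continuity of [u]
   and the rounding of its values. *)
have [N NP] := natr_ge (Num.max (2 / d0 + 1) (4 * k%:R * Lam%:R / e)).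
move: NP; rewrite ge_max => /andP[N1 N2].
have N0 : 0 < N%:R :> R by apply: lt_le_trans N1; rewrite addr_gt0// divr_gt0.
have Nn0 : N%:R != 0 :> R by rewrite gt_eqF.
pose eta : R := N%:R^-1; have eta0 : 0 < eta by rewrite invr_gt0.
have etad : 2 * eta < d0.
  have : 2 / d0 < N%:R by lra.
  by rewrite ltr_pdivrMr// /eta ltr_pdivrMr// mulrC.
have etae : Lam%:R * (k%:R * (2 * eta)) <= e / 2.
  move: N2; rewrite ler_pdivrMr// => N2.
  rewrite /eta; rewrite (_ : _ * _ = (4 * k%:R * Lam%:R) / N%:R / 2); last by field.
  by rewrite ler_pM2r ?invr_gt0// ler_pdivrMr// [leRHS]mulrC.
have Lamd : 2 * U%:R <= Lam%:R * (d0 / 2).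
  by move: LamP; rewrite ler_pdivrMr// => LamP; lra.
pose n := (2 * B * N).+1.
pose p (j : 'I_n) : rat := j%:R / N%:R - B%:R.
have pE j : ratr (p j) = j%:R * eta - B%:R :> R.
  by rewrite /p rmorphB /= fmorph_div /= !ratr_nat.
have pB j : `|ratr (p j) : R| <= B%:R.
  rewrite pE ler_norml lerBrDl subrr mulr_ge0 ?(ltW eta0)//= lerBlDr.
  rewrite ler_pdivrMr// -natrD -natrM ler_nat addnn -mul2n.
  by have := ltn_ord j; rewrite ltnS.
have pP (x : R) : `|x| <= B%:R -> exists j, `|x - ratr (p j)| <= eta.
  rewrite ler_norml => /andP[x1 x2].
  have y0 : 0 <= (x + B%:R) * N%:R by rewrite mulr_ge0// -lerBlDr sub0r.
  have /andP[t1 t2] := truncn_itv y0.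
  have jn : (Num.truncn ((x + B%:R) * N%:R)%R < n)%N.
    rewrite ltnS -(ler_nat R) (le_trans t1)// !natrM ler_pM2r//.
    by rewrite mulrDl mul1r lerD2r.
  exists (Ordinal jn); rewrite pE /=.
  move: t1 t2; set t := Num.truncn _; rewrite -addn1 natrD => t1 t2.
  rewrite /eta -[leRHS]mul1r ler_pdivlMr// -[X in _ * X <= _](gtr0_norm N0) -normrM.
  rewrite (_ : _ * N%:R = (x + B%:R) * N%:R - t%:R); last by field.
  by rewrite ler_norml; apply/andP; split; lra.
pose pt (g : {ffun 'I_k -> 'I_n}) : 'rV[R]_k := \row_i ratr (p (g i)).
have ptB g : box B%:R (pt g) by move=> i; rewrite mxE.
have /choice[q qP] : forall g, exists q : rat, `|u (pt g) - ratr q| <= e / 4.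
  by move=> g; have [q [_ Hq]] := rat_toward_zero (u (pt g)) e40; exists q.
exists eta => //.
(* The fold needs a base formula; the constant [- U] does not exceed any value of [u] on the box. *)
exists (fun F => cmax (enum {ffun 'I_k -> 'I_n}) (fun g =>
  CPlus (CConst (q g)) (CTimes (- Lam%:R)
    (csum (enum 'I_k) (fun i => cnorm (CPlus (F i) (CConst (- p (g i))))))))
  (CConst (- U%:R))).
move=> M s F v Bv vF.
have NE (m : nat) : ratr (- m%:R) = - m%:R :> R by rewrite rmorphN /= ratr_nat.
have gE g : cform_val s (CPlus (CConst (q g)) (CTimes (- Lam%:R)
    (csum (enum 'I_k) (fun i => cnorm (CPlus (F i) (CConst (- p (g i)))))))) =
  ratr (q g) - Lam%:R * \sum_i `|cform_val s (F i) - pt g 0 i|.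
  rewrite [LHS]/= csum_val big_enum NE mulNr; congr (_ - _ * _).
  by apply: eq_bigr => i _; rewrite cnorm_val /= rmorphN mxE.
have uv := uU _ Bv; move: uv; rewrite ler_norml => /andP[uv _].
rewrite ler_norml; apply/andP; split; last first.
  have /choice[g0 g0P] : forall i, exists j, `|v 0 i - ratr (p j)| <= eta.
    by move=> i; apply: pP; exact: Bv.
  pose g := [ffun i => g0 i].
  have vg : `|u v - u (pt g)| < e / 4.
    by apply: ud0 => // i; rewrite mxE ffunE; apply: le_lt_trans (g0P i) _; lra.
  have gs : \sum_i `|cform_val s (F i) - pt g 0 i| <= k%:R * (2 * eta).
    rewrite -[k in k%:R]card_ord mulr_natl -sumr_const; apply: ler_sum => i _.
    have := vF i; have := g0P i; rewrite mxE ffunE !ler_norml.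
    by move=> /andP[? ?] /andP[? ?]; apply/andP; split; lra.
  have := ler_wpM2l (ler0n R Lam) gs.
  have := qP g; move: vg; rewrite ltr_norml ler_norml => /andP[_ vg] /andP[_ qg] sg.
  rewrite lerBlDr -lerBlDl; apply: le_trans; last first.
    by apply: (cmax_val_ge s _ _ (i := g)); rewrite mem_enum.
  rewrite gE; lra.
rewrite lerBrDr -lerBrDl opprK; apply: cmax_val_le.
  by rewrite /= NE; lra.
move=> g; rewrite gE.
have s0 : 0 <= \sum_i `|cform_val s (F i) - pt g 0 i| by exact: sumr_ge0.
have Ls0 := mulr_ge0 (ler0n R Lam) s0.
have := qP g; rewrite ler_norml => /andP[qg1 qg2].
(* No entry of the maximum may exceed [u v] by more than [e]: near grid points by uniform
   continuity, far ones because of their penalty. *)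
have [near|/existsNP[i /negP]] := pselect (forall i, `|v 0 i - pt g 0 i| < d0).
  have := ud0 _ _ Bv near; rewrite ltr_norml => /andP[? ?]; lra.
rewrite -leNgt => far.
have : d0 / 2 <= \sum_i `|cform_val s (F i) - pt g 0 i|.
  rewrite (bigD1 i) //= ler_wpDr ?sumr_ge0//.
  have h := ler_distD (cform_val s (F i)) (v 0 i) (pt g 0 i).
  have := vF i; lra.
move=> /(ler_wpM2l (ler0n R Lam)) sg.
have := uU _ (ptB g); rewrite ler_norml => /andP[_ ug]; lra.
Qed.

End Connectives.

Section Approximation.
Variable R : realType.
Implicit Type M : structure R.

Definition env_agree n M (s : seq M) (e : 'I_n -> M) :=
  forall i : 'I_n, e i = nth (op_zero M) s i.

Lemma env_agree_cons n M (s : seq M) (e : 'I_n -> M) x :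
  env_agree s e -> env_agree (x :: s) (env_cons x e).
Proof.
by move=> se i; rewrite /env_cons; case: unliftP => [j ->|->]//=; exact: se.
Qed.

(** The domain bound [B] comes before [e], because the accuracy required of the factors of a
    product, or under a scalar, depends on the domains in which the subterms live. *)
Lemma term_approx n (t : term R n) L : exists B, forall e, 0 < e ->
  exists c, forall M (s : seq M) env, tame M -> env_dom L s -> env_agree s env ->
    [/\ dom B (eval_term env t), dom B (cterm_val s c) &
      mdist (eval_term env t) (cterm_val s c) <= e].
Proof.
elim: t => [i|||t [B IHt] u [C IHu]|t [B IHt] u [C IHu]|t [B IHt]|l t [B IHt]|t [B IHt]].
- exists L => e e0; exists (CVar i) => M s env T sL se /=.
  by rewrite se mdistxx ltW.
- exists 0%N => e e0; exists CZero => M s env T sL se /=.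
  by rewrite mdistxx ltW//; split=> //; exact: dom_zero.
- exists 1%N => e e0; exists COne => M s env T sL se /=.
  by rewrite mdistxx ltW//; split=> //; exact: dom_one.
- exists (B + C)%N => e e0; have e20 : 0 < e / 2 by rewrite divr_gt0.
  have [c Hc] := IHt _ e20; have [d Hd] := IHu _ e20.
  exists (CAdd c d) => M s env T sL se /=.
  have [c1 c2 c3] := Hc M s env T sL se; have [d1 d2 d3] := Hd M s env T sL se.
  split; [exact: dom_add|exact: dom_add|].
  by rewrite (splitr e) (le_trans (mod_add c1 c2 d1 d2))// lerD.
- exists (B * C)%N => e e0; pose K : R := B%:R + C%:R + 1.
  have K0 : 0 < K by rewrite /K ltr_wpDl ?addr_ge0.
  have eK0 : 0 < e / K by rewrite divr_gt0.
  have [c Hc] := IHt _ eK0; have [d Hd] := IHu _ eK0.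
  exists (CMul c d) => M s env T sL se /=.
  have [c1 c2 c3] := Hc M s env T sL se; have [d1 d2 d3] := Hd M s env T sL se.
  split; [exact: dom_mul|exact: dom_mul|].
  apply: le_trans (mod_mul c1 c2 d1 d2) _.
  have := ler_wpM2l (ler0n R C) c3; have := ler_wpM2l (ler0n R B) d3.
  have : e = K * (e / K) by rewrite mulrC divfK ?gt_eqF.
  have := ltW eK0; rewrite {3}/K; set y := e / K => y0 -> h1 h2.
  by rewrite !mulrDl mul1r; lra.
- exists B => e e0; have [c Hc] := IHt _ e0.
  exists (CStar c) => M s env T sL se /=.
  have [c1 c2 c3] := Hc M s env T sL se.
  split; [exact: dom_star|exact: dom_star|].
  exact: le_trans (mod_star c1 c2) _.
- have [C HC] := natr_ge (normc l * B%:R); exists C => e e0.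
  have [n1 Hn1] := natr_ge (normc l).
  have e20 : 0 < e / 2 by rewrite divr_gt0.
  have B0 : 0 < B%:R + 1 :> R by rewrite ltr_wpDl.
  have n0 : 0 < n1%:R + 1 :> R by rewrite ltr_wpDl.
  have eB0 : 0 < e / 2 / (B%:R + 1) by rewrite divr_gt0.
  have en0 : 0 < e / 2 / (n1%:R + 1) by rewrite divr_gt0.
  have [q [q1 q2]] := rat_scalar_toward_zero l eB0.
  have [c Hc] := IHt _ en0.
  exists (CScale q c) => M s env T sL se /=.
  have [c1 c2 c3] := Hc M s env T sL se.
  split; [exact: dom_scale HC _|apply: dom_scale c2|].
    by apply: le_trans HC; rewrite ler_wpM2r.
  rewrite (splitr e); apply: le_trans (metric_triangle _ (op_scale l (cterm_val s c)) _) _.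
  rewrite lerD//.
    apply: le_trans (mod_scale _ c1 c2) _.
    have -> : e / 2 = (n1%:R + 1) * (e / 2 / (n1%:R + 1)).
      by rewrite [RHS]mulrC divfK ?gt_eqF.
    by rewrite ler_pM ?normc_ge0 ?mdist_ge0// (le_trans Hn1)// lerDl.
  apply: le_trans (T.2 _ _ _ _ c2) _.
  have -> : e / 2 = (e / 2 / (B%:R + 1)) * (B%:R + 1) by rewrite divfK ?gt_eqF.
  by rewrite ler_pM ?normc_ge0// lerDl.
- exists B => e e0; have [c Hc] := IHt _ e0.
  exists (CSigma c) => M s env T sL se /=.
  have [c1 c2 c3] := Hc M s env T sL se.
  split; [exact: dom_sigma|exact: dom_sigma|].
  exact: le_trans (mod_sigma c1 c2) _.
Qed.

Lemma formula_approx n (phi : formula R n) L e : 0 < e ->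
  exists f, forall M (s : seq M) env, tame M -> env_dom L s -> env_agree s env ->
    `|Defs.eval phi env - cform_val s f| <= e.
Proof.
elim: phi L e => {n} [n t u|n k u cu psi IH|n m phi IH|n m phi IH] L e e0.
- have e20 : 0 < e / 2 by rewrite divr_gt0.
  have [B /(_ _ e20)[c Hc]] := term_approx t L.
  have [C /(_ _ e20)[d Hd]] := term_approx u L.
  exists (CDist c d) => M s env T sL se /=.
  have [_ _] := Hc M s env T sL se; have [_ _] := Hd M s env T sL se.
  set x := eval_term env t; set y := eval_term env u.
  set x' := cterm_val s c; set y' := cterm_val s d => yy xx.
  have h1 := metric_triangle x x' y; have h2 := metric_triangle x' y' y.
  have h3 := metric_triangle x' x y'; have h4 := metric_triangle x y y'.
  have h5 := metric_sym x x'; have h6 := metric_sym y y'.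
  by rewrite ler_norml; apply/andP; split; lra.
(* Approximants within 1 bound the subformulas uniformly in the structure. This confines the
   arguments of [u] to a box, before the accuracy [d] required of them is known. *)
- have /choice[B HB] : forall i, exists B : nat, forall M (s : seq M) env,
      tame M -> env_dom L s -> env_agree s env -> `|Defs.eval (psi i) env| <= B%:R.
    move=> i; have [f fP] := IH i L 1 ltr01; have [B HB] := cform_bounded R f L.
    exists B.+1 => M s env T sL se; have := fP M s env T sL se.
    have := HB M s T sL; rewrite -(subrK (cform_val s f) (Defs.eval (psi i) env)).
    rewrite -addn1 natrD => h1; rewrite addrK => h2.
    by rewrite (le_trans (ler_normD _ _))// addrC lerD.
  have [d d0 [Th ThP]] := cform_connective (\max_i B i)%N cu e0.
  have /choice[F FP] := fun i => IH i L d d0.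
  exists (Th F) => M s env T sL se /=; apply: ThP => i.
    rewrite mxE; apply: le_trans (HB i M s env T sL se) _.
    by rewrite ler_nat leq_bigmax.
  by rewrite mxE; exact: FP.
- have [f fP] := IH (maxn m L) e e0.
  have [B HB] := cform_bounded R f (maxn m L); exists (CSup m f) => M s env T sL se /=.
  have agree x : dom m x -> `|Defs.eval phi (env_cons x env) - cform_val (x :: s) f| <= e.
    by move=> mx; apply: fP => //; [exact: env_dom_cons|exact: env_agree_cons].
  have bd x : dom m x -> `|cform_val (x :: s) f| <= B%:R.
    by move=> mx; apply: HB => //; exact: env_dom_cons.
  apply: (@dist_sup_le _ _ _ _ _ (B%:R + e)) => //.
  + by exists (op_zero M); exact: tame_dom0.
  + move=> x mx; rewrite -[Defs.eval _ _](subrK (cform_val (x :: s) f)) addrC.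
    by rewrite (le_trans (ler_normD _ _))// lerD ?bd ?agree.
  + by move=> x mx; rewrite (le_trans (bd _ mx))// lerDl ltW.
- have [f fP] := IH (maxn m L) e e0.
  have [B HB] := cform_bounded R f (maxn m L).
  (* Infima are absent from the countable formulas and are written as negated suprema. *)
  exists (CTimes (-1) (CSup m (CTimes (-1) f))) => M s env T sL se /=.
  have agree x : dom m x -> `|Defs.eval phi (env_cons x env) - cform_val (x :: s) f| <= e.
    by move=> mx; apply: fP => //; [exact: env_dom_cons|exact: env_agree_cons].
  have bd x : dom m x -> `|cform_val (x :: s) f| <= B%:R.
    by move=> mx; apply: HB => //; exact: env_dom_cons.
  rewrite sup_opp_inf rmorphN1 mulN1r -opprD normrN.
  apply: (@dist_sup_le _ _ _ _ _ (B%:R + e)) => //.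
  + by exists (op_zero M); exact: tame_dom0.
  + move=> x mx; rewrite normrN -[Defs.eval _ _](subrK (cform_val (x :: s) f)) addrC.
    by rewrite (le_trans (ler_normD _ _))// lerD ?bd ?agree.
  + by move=> x mx; rewrite mulN1r normrN (le_trans (bd _ mx))// lerDl ltW.
  + by move=> x mx; rewrite mulN1r -opprD normrN agree.
Qed.

End Approximation.

(** * Ultrapowers *)

Lemma cauchy_mdistP (R : realType) (T : metricType R) (u : nat -> T) :
  cauchy (u @ \oo) <-> forall e, 0 < e -> exists N, forall i j,
    (N <= i)%N -> (N <= j)%N -> mdist (u i) (u j) < e.
Proof.
split=> [/cauchy_ballP uC e e0|H].
  have [[P Q] /= [[N1 _ hP] [N2 _ hQ]] PQ] := uC _ e0.
  exists (maxn N1 N2) => i j; rewrite !geq_max => /andP[i1 i2] /andP[j1 j2].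
  have := PQ (u i, u j); rewrite /= ballEmdist /=; apply.
  by split; [exact: hP|exact: hQ].
apply: cauchy_exP => e e0; have [N HN] := H _ e0.
exists (u N); exists N => // k /= Nk; rewrite ballEmdist /=; exact: HN.
Qed.

Lemma cvg_mdistP (R : realType) (T : metricType R) (u : nat -> T) (x : T) :
  (u @ \oo --> x) <-> forall e, 0 < e -> exists N, forall k, (N <= k)%N ->
    mdist x (u k) < e.
Proof.
rewrite metricType_numDomainType.cvgrPdist_lt; split=> H e /H.
  by move=> [N _ HN]; exists N => k Nk; exact: HN.
by move=> [N HN]; exists N.
Qed.

Lemma ultra_cvg (R : realType) (I : Type) (U : set_system I) (u : I -> R) (B : R) :
  UltraFilter U -> (forall k, `|u k| <= B) -> exists l : R, u @ U --> l.
Proof.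
move=> UU uB; have uUin : (u @ U) `[- B, B]%classic.
  by by apply: (@filterE _ U) => k /=; rewrite in_itv /= -ler_norml.
have [p [_ pc]] := @segment_compact R (- B) B (u @ U) _ uUin.
exists p => V Vp; have [//|nV] := in_ultra_setVsetC (u @^-1` V) UU.
by have [x [/= nVx Vx]] := pc (~` V) V nV Vp.
Qed.

Lemma nth_map_default (T1 T2 : Type) (f : T1 -> T2) x0 y0 s i : f x0 = y0 ->
  nth y0 (map f s) i = f (nth x0 s i).
Proof. by move=> f0; elim: s i => [|x s IH] [|i] //=. Qed.

Section Ultrapower.
Variables (R : realType) (A : structure R) (U : set_system nat).
Hypothesis UU : UltraFilter U.
Local Open Scope quotient_scope.

Definition bounded_seq :=
  {x : nat -> A | `[< exists n, forall k, dom n (x k) >]}.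
Implicit Types x y z : bounded_seq.

Definition bs_val x : nat -> A := val x.
Local Coercion bs_val : bounded_seq >-> Funclass.

Lemma bs_bound x : exists n, forall k, dom n (x k).
Proof. by have /asboolP := valP x. Qed.

Definition mk_bs (u : nat -> A) (h : exists n, forall k, dom n (u k)) :
  bounded_seq := exist _ u (asboolT h).

Lemma mk_bsE u (h : exists n, forall k, dom n (u k)) k : mk_bs h k = u k.
Proof. by []. Qed.

Definition udist x y : R := lim ((fun k => mdist (x k) (y k)) @ U).

Hypothesis tA : tame A.

Lemma bs_bound2 x y : exists n, (forall k, dom n (x k)) /\ (forall k, dom n (y k)).
Proof.
have [m mx] := bs_bound x; have [n ny] := bs_bound y; exists (maxn m n).
by split=> k; [apply: tame_dom (mx k)|apply: tame_dom (ny k)];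
  rewrite // ?leq_maxl ?leq_maxr.
Qed.

Lemma udist_cvg x y : (fun k => mdist (x k) (y k)) @ U --> udist x y.
Proof.
have [n [nx ny]] := bs_bound2 x y.
have [|l ul] := @ultra_cvg R nat U (fun k => mdist (x k) (y k)) (2 * n)%N%:R UU.
  by move=> k; rewrite ger0_norm ?mdist_ge0//; exact: dom_bounded.
by rewrite /udist (cvg_lim _ ul).
Qed.
Arguments udist_cvg : clear implicits.

(** All moduli of continuity are linear inequalities between distances, so this one passage to the
    limit gives the triangle inequality, the independence of representatives and the moduli of the
    ultrapower. *)
Lemma udist_le2 (a b : R) x x' y y' z z' :
  (forall k, mdist (z k) (z' k) <= a * mdist (x k) (x' k) + b * mdist (y k) (y' k)) ->
  udist z z' <= a * udist x x' + b * udist y y'.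
Proof.
move=> H; apply: (ler_cvg_to (udist_cvg z z') (cvgD
  (cvgM (cvg_cst a) (udist_cvg x x')) (cvgM (cvg_cst b) (udist_cvg y y')))).
by apply: filterE => k; exact: H.
Qed.

Lemma udist_le (a : R) x x' z z' :
  (forall k, mdist (z k) (z' k) <= a * mdist (x k) (x' k)) ->
  udist z z' <= a * udist x x'.
Proof.
move=> H; rewrite -[leRHS]addr0 -[X in _ + X](mul0r (udist x x)).
by apply: udist_le2 => k; rewrite mul0r addr0.
Qed.

Lemma udist_near_le x y (c : R) :
  (\forall k \near U, mdist (x k) (y k) <= c) -> udist x y <= c.
Proof. by move=> H; exact: (ler_cvg_to (udist_cvg x y) (cvg_cst c) H). Qed.

Lemma udist_near_ge x y (c : R) :
  (\forall k \near U, c <= mdist (x k) (y k)) -> c <= udist x y.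
Proof. by move=> H; exact: (ler_cvg_to (cvg_cst c) (udist_cvg x y) H). Qed.

Lemma udist_near_lt x y (c : R) :
  udist x y < c -> \forall k \near U, mdist (x k) (y k) < c.
Proof. by move=> xyc; exact: (udist_cvg x y [set r | r < c] (lt_nbhsl xyc)). Qed.

Lemma udist_ge0 x y : 0 <= udist x y.
Proof. by apply: udist_near_ge; apply: filterE => k; exact: mdist_ge0. Qed.

Lemma udistxx x : udist x x = 0.
Proof.
apply/eqP; rewrite eq_le udist_ge0 andbT; apply: udist_near_le.
by apply: filterE => k; rewrite mdistxx.
Qed.

Lemma udist_sym x y : udist x y = udist y x.
Proof. by rewrite /udist; under eq_fun do rewrite metric_sym. Qed.

Lemma udist_triangle y x z : udist x z <= udist x y + udist y z.
Proof.
rewrite -[udist x y]mul1r -[udist y z]mul1r; apply: udist_le2 => k.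
by rewrite !mul1r; exact: metric_triangle.
Qed.

Definition ueq x y : bool := udist x y == 0.

Lemma ueq_refl : reflexive ueq. Proof. by move=> x; rewrite /ueq udistxx. Qed.

Lemma ueq_sym : symmetric ueq. Proof. by move=> x y; rewrite /ueq udist_sym. Qed.

Lemma ueq_trans : transitive ueq.
Proof.
move=> y x z /eqP xy /eqP yz; rewrite /ueq eq_le udist_ge0 andbT.
by have := udist_triangle y x z; rewrite xy yz addr0.
Qed.

Definition ueq_rel := EquivRel ueq ueq_refl ueq_sym ueq_trans.

Definition ultrapower : Type := {eq_quot ueq_rel}.
HB.instance Definition _ := Choice.on ultrapower.

Definition upi x : ultrapower := \pi_({eq_quot ueq_rel}) x.
Definition urepr (p : ultrapower) : bounded_seq := repr (p : {eq_quot ueq_rel}).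

Lemma ureprK p : upi (urepr p) = p. Proof. exact: reprK. Qed.

Lemma upi_eq x y : upi x = upi y <-> udist x y = 0.
Proof.
split=> [/eqquotP/eqP//|xy]; apply/eqquotP; exact/eqP.
Qed.

Lemma udist_repr x : udist (urepr (upi x)) x = 0.
Proof. by apply/upi_eq; rewrite ureprK. Qed.

Definition qdist p q := udist (urepr p) (urepr q).

Lemma qdistE x y : qdist (upi x) (upi y) = udist x y.
Proof.
rewrite /qdist; have hx := udist_repr x; have hy := udist_repr y.
set x' := urepr (upi x) in hx *; set y' := urepr (upi y) in hy *.
have h1 := udist_triangle x x' y'; have h2 := udist_triangle y x y'.
have h3 := udist_triangle x' x y; have h4 := udist_triangle y' x' y.
have h5 := udist_sym x x'; have h6 := udist_sym y y'.
by apply/eqP; rewrite eq_le; apply/andP; split; lra.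
Qed.

Lemma qdistxx p : qdist p p = 0. Proof. exact: udistxx. Qed.

Lemma qdist_positivity p q : qdist p q = 0 -> p = q.
Proof. by rewrite -(ureprK p) -(ureprK q) qdistE => /upi_eq. Qed.

Lemma qdist_sym p q : qdist p q = qdist q p. Proof. exact: udist_sym. Qed.

Lemma qdist_triangle q p r : qdist p r <= qdist p q + qdist q r.
Proof. exact: udist_triangle. Qed.

HB.instance Definition _ := @isMetric.Build R ultrapower
  qdist qdistxx qdist_positivity qdist_sym qdist_triangle.

Lemma mdist_upi x y : mdist (upi x) (upi y) = udist x y.
Proof. exact: qdistE. Qed.

(** Some representative has to stay in the domain; the chosen one, [urepr p], may leave it. *)
Definition udom n : set ultrapower :=
  [set p | exists2 x : bounded_seq, forall k, dom n (x k) & upi x = p].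

Lemma bs_add_subproof x y : exists n, forall k, dom n (op_add (x k) (y k)).
Proof.
have [m mx] := bs_bound x; have [n ny] := bs_bound y; exists (m + n)%N => k.
exact: dom_add.
Qed.

Lemma bs_mul_subproof x y : exists n, forall k, dom n (op_mul (x k) (y k)).
Proof.
have [m mx] := bs_bound x; have [n ny] := bs_bound y; exists (m * n)%N => k.
exact: dom_mul.
Qed.

Lemma bs_star_subproof x : exists n, forall k, dom n (op_star (x k)).
Proof. by have [n nx] := bs_bound x; exists n => k; exact: dom_star. Qed.

Lemma bs_scale_subproof l x : exists n, forall k, dom n (op_scale l (x k)).
Proof.
have [m mx] := bs_bound x; have [n Hn] := natr_ge (normc l * m%:R).
by exists n => k; exact: dom_scale Hn _.
Qed.

Lemma bs_sigma_subproof x : exists n, forall k, dom n (op_sigma (x k)).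
Proof. by have [n nx] := bs_bound x; exists n => k; exact: dom_sigma. Qed.

Definition bs_zero : bounded_seq :=
  @mk_bs (fun=> op_zero A) (ex_intro _ 0%N (fun=> dom_zero A)).
Definition bs_one : bounded_seq :=
  @mk_bs (fun=> op_one A) (ex_intro _ 1%N (fun=> dom_one A)).
Definition bs_add x y : bounded_seq := mk_bs (bs_add_subproof x y).
Definition bs_mul x y : bounded_seq := mk_bs (bs_mul_subproof x y).
Definition bs_star x : bounded_seq := mk_bs (bs_star_subproof x).
Definition bs_scale l x : bounded_seq :=
  mk_bs (bs_scale_subproof l x).
Definition bs_sigma x : bounded_seq := mk_bs (bs_sigma_subproof x).

Definition uzero := upi bs_zero.
Definition uone := upi bs_one.
Definition uadd p q := upi (bs_add (urepr p) (urepr q)).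
Definition umul p q := upi (bs_mul (urepr p) (urepr q)).
Definition ustar p := upi (bs_star (urepr p)).
Definition uscale l p := upi (bs_scale l (urepr p)).
Definition usigma p := upi (bs_sigma (urepr p)).

Lemma le0_upi_eq x y : udist x y <= 0 -> upi x = upi y.
Proof. by move=> xy; apply/upi_eq/eqP; rewrite eq_le xy udist_ge0. Qed.

Lemma uaddE x y : uadd (upi x) (upi y) = upi (bs_add x y).
Proof.
apply: le0_upi_eq; set x' := urepr _; set y' := urepr _.
have [m [mx mx']] := bs_bound2 x x'; have [n [ny ny']] := bs_bound2 y y'.
rewrite (le_trans (@udist_le2 1 1 x' x y' y _ _ _))// ?udist_repr ?mulr0 ?addr0//.
by move=> k; rewrite !mul1r; exact: mod_add.
Qed.

Lemma umulE x y : umul (upi x) (upi y) = upi (bs_mul x y).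
Proof.
apply: le0_upi_eq; set x' := urepr _; set y' := urepr _.
have [m [mx mx']] := bs_bound2 x x'; have [n [ny ny']] := bs_bound2 y y'.
rewrite (le_trans (@udist_le2 n%:R m%:R x' x y' y _ _ _))// ?udist_repr ?mulr0 ?addr0//.
by move=> k; exact: mod_mul.
Qed.

Lemma ustarE x : ustar (upi x) = upi (bs_star x).
Proof.
apply: le0_upi_eq; set x' := urepr _; have [m [mx mx']] := bs_bound2 x x'.
rewrite (le_trans (@udist_le 1 x' x _ _ _))// ?udist_repr ?mulr0//.
by move=> k; rewrite mul1r; exact: mod_star.
Qed.

Lemma uscaleE l x : uscale l (upi x) = upi (bs_scale l x).
Proof.
apply: le0_upi_eq; set x' := urepr _; have [m [mx mx']] := bs_bound2 x x'.
rewrite (le_trans (@udist_le (normc l) x' x _ _ _))// ?udist_repr ?mulr0//.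
by move=> k; exact: mod_scale.
Qed.

Lemma usigmaE x : usigma (upi x) = upi (bs_sigma x).
Proof.
apply: le0_upi_eq; set x' := urepr _; have [m [mx mx']] := bs_bound2 x x'.
rewrite (le_trans (@udist_le 1 x' x _ _ _))// ?udist_repr ?mulr0//.
by move=> k; rewrite mul1r; exact: mod_sigma.
Qed.

Lemma udom_cover p : exists n, udom n p.
Proof.
by have [n nx] := bs_bound (urepr p); exists n, (urepr p); rewrite ?ureprK.
Qed.

Lemma udom_bounded n p q : udom n p -> udom n q -> mdist p q <= (2 * n)%N%:R.
Proof.
move=> [x nx <-] [y ny <-]; rewrite mdist_upi; apply: udist_near_le.
by apply: filterE => k; exact: dom_bounded.
Qed.

Lemma udom_zero : udom 0 uzero.
Proof. by exists bs_zero => // k; exact: dom_zero. Qed.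

Lemma udom_one : udom 1 uone.
Proof. by exists bs_one => // k; exact: dom_one. Qed.

Lemma udom_add m n p q : udom m p -> udom n q -> udom (m + n) (uadd p q).
Proof.
move=> [x mx <-] [y ny <-]; exists (bs_add x y); last by rewrite uaddE.
by move=> k; exact: dom_add.
Qed.

Lemma udom_mul m n p q : udom m p -> udom n q -> udom (m * n) (umul p q).
Proof.
move=> [x mx <-] [y ny <-]; exists (bs_mul x y); last by rewrite umulE.
by move=> k; exact: dom_mul.
Qed.

Lemma udom_star n p : udom n p -> udom n (ustar p).
Proof.
move=> [x nx <-]; exists (bs_star x); last by rewrite ustarE.
by move=> k; exact: dom_star.
Qed.

Lemma udom_scale m n l p :
  normc l * m%:R <= n%:R -> udom m p -> udom n (uscale l p).
Proof.
move=> lmn [x nx <-]; exists (bs_scale l x); last by rewrite uscaleE.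
by move=> k; exact: dom_scale lmn _.
Qed.

Lemma udom_sigma n p : udom n p -> udom n (usigma p).
Proof.
move=> [x nx <-]; exists (bs_sigma x); last by rewrite usigmaE.
by move=> k; exact: dom_sigma.
Qed.

Lemma umod_add m n p p' q q' : udom m p -> udom m p' -> udom n q -> udom n q' ->
  mdist (uadd p q) (uadd p' q') <= mdist p p' + mdist q q'.
Proof.
move=> [x mx <-] [x' mx' <-] [y ny <-] [y' ny' <-]; rewrite !uaddE !mdist_upi.
rewrite -[udist x x']mul1r -[udist y y']mul1r; apply: udist_le2 => k.
by rewrite !mul1r; exact: mod_add.
Qed.

Lemma umod_mul m n p p' q q' : udom m p -> udom m p' -> udom n q -> udom n q' ->
  mdist (umul p q) (umul p' q') <= n%:R * mdist p p' + m%:R * mdist q q'.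
Proof.
move=> [x mx <-] [x' mx' <-] [y ny <-] [y' ny' <-]; rewrite !umulE !mdist_upi.
by apply: udist_le2 => k; exact: mod_mul.
Qed.

Lemma umod_star n p q : udom n p -> udom n q ->
  mdist (ustar p) (ustar q) <= mdist p q.
Proof.
move=> [x nx <-] [y ny <-]; rewrite !ustarE !mdist_upi -[leRHS]mul1r.
by apply: udist_le => k; rewrite mul1r; exact: mod_star.
Qed.

Lemma umod_scale n l p q : udom n p -> udom n q ->
  mdist (uscale l p) (uscale l q) <= normc l * mdist p q.
Proof.
move=> [x nx <-] [y ny <-]; rewrite !uscaleE !mdist_upi.
by apply: udist_le => k; exact: mod_scale.
Qed.

Lemma umod_sigma n p q : udom n p -> udom n q ->
  mdist (usigma p) (usigma q) <= mdist p q.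
Proof.
move=> [x nx <-] [y ny <-]; rewrite !usigmaE !mdist_upi -[leRHS]mul1r.
by apply: udist_le => k; rewrite mul1r; exact: mod_sigma.
Qed.

Hypothesis oU : \oo `<=` U.

(* Diagonal argument: [w k] follows the [i]-th sequence of a fast subsequence,
   for the largest [i <= k] up to which these sequences are close at [k]. *)
Lemma udom_complete n (u : nat -> ultrapower) : (forall k, udom n (u k)) ->
  cauchy (u @ \oo) -> exists2 p : ultrapower, udom n p & u @ \oo --> p.
Proof.
move=> un /cauchy_mdistP uC; pose h (i : nat) : R := i.+1%:R^-1.
have h0 i : 0 < h i by rewrite invr_gt0.
have /choice[N NP] := fun i => uC _ (h0 i).
(* The sum is a simple index beyond [N a] for all [a <= i] at once. *)
pose J i := \sum_(a < i.+1) N a.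
have JN a i : (a <= i)%N -> (N a <= J i)%N.
  move=> ai; have ai' : (a < i.+1)%N by [].
  by rewrite /J (bigD1 (Ordinal ai')) //= leq_addr.
have /choice[z zP] : forall i, exists x : bounded_seq,
    (forall k, dom n (x k)) /\ upi x = u (J i).
  by move=> i; have [x nx xu] := un (J i); exists x.
have zd a b : (a <= b)%N -> udist (z a) (z b) < h a.
  by move=> ab; rewrite -mdist_upi !(zP _).2; apply: NP; apply: JN.
pose V i k := (i <= k)%N /\ forall a b : nat, (a <= b)%N -> (b <= i)%N ->
  mdist (z a k) (z b k) < h a.
have VU i : U (V i).
  apply: filterI; first by apply: oU; exists i.
  have : \forall k \near U, forall b : 'I_i.+1, forall a : 'I_b.+1,
      mdist (z a k) (z b k) < h a.
    apply: filter_forall => b; apply: filter_forall => a.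
    by apply: udist_near_lt; apply: zd; rewrite -ltnS.
  apply: filterS => k Hk a b ab bi; have ab' : (a < b.+1)%N by [].
  have bi' : (b < i.+1)%N by [].
  exact: (Hk (Ordinal bi') (Ordinal ab')).
(* Since [V 0 k] always holds and [V i k] forces [i <= k], a largest such [i] exists for every
   [k]. *)
have V0 k : V 0%N k.
  by split=> // a b ab; rewrite leqn0 => /eqP b0; move: ab; rewrite b0 leqn0 => /eqP ->;
     rewrite mdistxx.
have /choice[m mP] : forall k, exists m, V m k /\ forall i, V i k -> (i <= m)%N.
  move=> k; have exV : exists i, `[< V i k >] by exists 0%N; exact/asboolP.
  have Vk i : `[< V i k >] -> (i <= k)%N by move=> /asboolP[].
  case: (ex_maxnP exV Vk) => m /asboolP mV mmax; exists m; split=> // i Vi.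
  by apply: mmax; apply/asboolP.
pose w : bounded_seq := @mk_bs (fun k => z (m k) k) (ex_intro _ n (fun k => (zP (m k)).1 k)).
have zw i : udist (z i) w <= h i.
  apply: udist_near_le; apply: filterS (VU i) => k Vi.
  by have [[_ Vm] /(_ _ Vi) im] := mP k; apply/ltW/Vm.
exists (upi w); first by exists w => // k; exact: (zP (m k)).1.
apply/cvg_mdistP => e e0.
have [i hi] : exists i, h i < e / 2.
  have [i Hi] := natr_ge (2 / e); exists i; rewrite /h invf_plt ?posrE ?divr_gt0//.
  by rewrite invf_div (le_lt_trans Hi)// ltr_nat.
exists (J i) => k Jk; apply: le_lt_trans (metric_triangle _ (upi (z i)) _) _.
rewrite (splitr e) ltr_leD//.
  by rewrite mdist_upi udist_sym (le_lt_trans (zw i)).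
rewrite (zP i).2 ltW// (lt_trans _ hi)//; apply: NP; first exact: JN.
by rewrite (leq_trans _ Jk) ?JN.
Qed.

Definition ultrapower_structure : structure R :=
  @Structure R ultrapower udom uzero uone uadd umul ustar uscale usigma
    udom_cover udom_bounded udom_complete udom_zero udom_one udom_add udom_mul
    udom_star udom_scale udom_sigma umod_add umod_mul umod_star umod_scale
    umod_sigma.
Local Notation M := ultrapower_structure.

Lemma ultrapower_tame : tame M.
Proof.
split=> [n _ [x nx <-]|n l l' _ [x nx <-]].
  by exists x => // k; exact: tA.1.
rewrite /= !uscaleE mdist_upi; apply: udist_near_le.
by apply: filterE => k; exact: tA.2.
Qed.

(** The representative agrees with the values of the term in every coordinate, so distances between
    terms are literally instances of [udist]. *)
Lemma cterm_val_ultrapower (s : seq bounded_seq) t :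
  exists2 b : bounded_seq, (forall k, b k = cterm_val [seq x k | x : bounded_seq <- s] t) &
    cterm_val (map upi s : seq M) t = upi b.
Proof.
elim: t => /= [n|||t [b bE bt] u [c cE cu]|t [b bE bt] u [c cE cu]
  |t [b bE bt]|q t [b bE bt]|t [b bE bt]].
- exists (nth bs_zero s n); last exact: nth_map_default.
  by move=> k; rewrite (@nth_map_default _ _ (fun x : bounded_seq => x k) bs_zero).
- by exists bs_zero.
- by exists bs_one.
- by exists (bs_add b c) => [k|]; rewrite ?bt ?cu ?[LHS]uaddE -?bE -?cE.
- by exists (bs_mul b c) => [k|]; rewrite ?bt ?cu ?[LHS]umulE -?bE -?cE.
- by exists (bs_star b) => [k|]; rewrite ?bt ?[LHS]ustarE -?bE.
- by exists (bs_scale (rat_scalar R q) b) => [k|]; rewrite ?bt ?[LHS]uscaleE -?bE.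
- by exists (bs_sigma b) => [k|]; rewrite ?bt ?[LHS]usigmaE -?bE.
Qed.

Lemma bs_seq_bound (s : seq bounded_seq) : exists L, forall k,
  env_dom L [seq x k | x : bounded_seq <- s].
Proof.
elim: s => [|x s [L HL]] /=; first by exists 0%N => k; exact: env_dom_nil.
have [m mx] := bs_bound x.
by exists (maxn m L) => k; exact: env_dom_cons.
Qed.

Lemma env_dom_upi L (s : seq bounded_seq) :
  (forall k, env_dom L [seq x k | x : bounded_seq <- s]) ->
  env_dom L (map upi s : seq M).
Proof.
move=> sL i; rewrite (@nth_map_default _ _ upi bs_zero)//.
exists (nth bs_zero s i) => // k; have := sL k i.
by rewrite (@nth_map_default _ _ (fun x : bounded_seq => x k) bs_zero).
Qed.

(** For a supremum, a nearly optimal element of the ultrapower has a representative inside the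
    domain, which bounds the coordinate suprema from below; conversely nearly optimal elements
    chosen in all coordinates form a bounded sequence, which bounds them from above. *)
Theorem los (s : seq bounded_seq) f :
  (fun k => cform_val [seq x k | x : bounded_seq <- s] f) @ U -->
  cform_val (map upi s : seq M) f.
Proof.
elim: f s => /= [t u|q|f IHf g IHg|f IHf g IHg|q f IHf|m f IHf] s.
- have [b bE ->] := cterm_val_ultrapower s t.
  have [c cE ->] := cterm_val_ultrapower s u.
  rewrite [mdist _ _]mdist_upi.
  by under eq_fun do rewrite -bE -cE; exact: udist_cvg.
- exact: cvg_cst.
- exact: cvgD.
- apply/cvgrPdist_le => e e0.
  have /cvgrPdist_le/(_ _ e0) := IHf s; have /cvgrPdist_le/(_ _ e0) := IHg s.
  by apply: filterS2 => k gk fk; exact: dist_max_le.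
- by apply: cvgM => //; exact: cvg_cst.
- have [L sL] := bs_seq_bound s; have sL' := env_dom_upi sL.
  have tM := ultrapower_tame; have [B HB] := cform_bounded R f (maxn m L).
  have A0 : @dom R A m !=set0 by exists (op_zero A); exact: tame_dom0.
  have M0 : @dom R M m !=set0 by exists (op_zero M); exact: tame_dom0.
  have bA k : has_sup [set cform_val (a :: [seq y k | y : bounded_seq <- s]) f | a in dom m].
    apply: (@has_sup_bounded _ _ _ _ B%:R) => // x mx.
    by apply: HB => //; exact: env_dom_cons.
  have bM : has_sup [set cform_val ((p : M) :: map upi s) f | p in dom m].
    apply: (@has_sup_bounded _ _ _ _ B%:R) => // x mx.
    by apply: HB => //; exact: env_dom_cons.
  apply/cvgrPdist_lt => e e0; have e20 : 0 < e / 2 by rewrite divr_gt0.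
  set S := sup _ in bM *.
  have [_ [_ [y my <-] <-] Sy] := sup_adherent e20 bM.
  have /choice[z zP] : forall k, exists a : A, dom m a /\
      sup [set cform_val (a :: [seq y k | y : bounded_seq <- s]) f | a in dom m] - e / 2 <
      cform_val (a :: [seq y k | y : bounded_seq <- s]) f.
    by move=> k; have [_ [x mx <-] xS] := sup_adherent e20 (bA k); exists x.
  pose z' := @mk_bs z (ex_intro _ m (fun k => (zP k).1)).
  have zS : cform_val ((upi z' : M) :: map upi s) f <= S.
    apply: ub_le_sup; first by case: bM.
    by exists (upi z') => //; exists z' => // k; exact: (zP k).1.
  have /cvgrPdist_lt/(_ _ e20) yl := IHf (y :: s).
  have /cvgrPdist_lt/(_ _ e20) zl := IHf (z' :: s).
  near=> k.
  have : `|cform_val ((upi y : M) :: map upi s) f -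
      cform_val (y k :: [seq x k | x : bounded_seq <- s]) f| < e / 2.
    by near: k; exact: yl.
  have : `|cform_val ((upi z' : M) :: map upi s) f -
      cform_val (z' k :: [seq x k | x : bounded_seq <- s]) f| < e / 2.
    by near: k; exact: zl.
  have yk : cform_val (y k :: [seq y k | y : bounded_seq <- s]) f <=
      sup [set cform_val (a :: [seq y k | y : bounded_seq <- s]) f | a in dom m].
    by apply: ub_le_sup; [case: (bA k)|exists (y k)].
  have [_] := zP k; rewrite mk_bsE in yk *.
  move: zS Sy yk; rewrite /S !ltr_norml.
  move=> zS Sy yk zk /andP[? ?] /andP[? ?]; apply/andP; split; lra.
Unshelve. all: by end_near.
Qed.

End Ultrapower.

(** * Separable elementary substructures *)

Lemma env_bounded (R : realType) (M : structure R) (s : seq M) : tame M ->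
  exists L, env_dom L s.
Proof.
move=> T; elim: s => [|x s [L sL]]; first by exists 0%N; exact: env_dom_nil.
have [n nx] := dom_cover x; exists (maxn n L); exact: env_dom_cons.
Qed.

Lemma cform_has_sup (R : realType) (M : structure R) (s : seq M) f m : tame M ->
  has_sup [set cform_val (x :: s) f | x in dom m].
Proof.
move=> T; have [L sL] := env_bounded s T.
have [B HB] := cform_bounded R f (maxn m L).
apply: (@has_sup_bounded _ _ _ _ B%:R).
  by exists (op_zero M); exact: tame_dom0.
by move=> x mx; apply: HB => //; exact: env_dom_cons.
Qed.

(** An approximate Tarski-Vaught condition: suprema need not be attained, so witnesses are asked for
    at every precision. The family itself need not be closed in [M]. *)
Definition skolem_hull (R : realType) (M : structure R) (I : Type) (v : I -> M) :=
  (forall t r, exists i, v i = cterm_val (map v r) t) /\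
  (forall f m e r, 0 < e -> exists2 i, dom m (v i) &
    sup [set cform_val (x :: map v r) f | x in dom m] - e <=
    cform_val (v i :: map v r) f).

(** The trees are closed Skolem terms: a leaf denotes [x0], and a node applies the term or witness
    function coded by its label to the values of its subtrees. The family is countable because its
    index type is. *)
Lemma skolem_hull_exists (R : realType) (M : structure R) (x0 : M) : tame M ->
  exists v : GenTree.tree nat -> M, skolem_hull v /\ exists i, v i = x0.
Proof.
move=> T.
have /choice[g gP] : forall p : cform * nat * nat * seq M, exists x : M,
    dom p.1.1.2 x /\
    sup [set cform_val (y :: p.2) p.1.1.1 | y in dom p.1.1.2] - p.1.2.+1%:R^-1 <=
    cform_val (x :: p.2) p.1.1.1.
  move=> [[[f m] j] s] /=; have j0 : 0 < j.+1%:R^-1 :> R by rewrite invr_gt0.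
  have [_ [x mx <-] xS] := sup_adherent j0 (cform_has_sup s f m T).
  by exists x; split=> //; exact: ltW.
pose F n s := match unpickle n : option (cterm + cform * nat * nat) with
  | Some (inl t) => cterm_val s t
  | Some (inr p) => g (p, s)
  | None => x0
  end.
pose fix v (t : GenTree.tree nat) : M := match t with
  | GenTree.Leaf _ => x0
  | GenTree.Node n ts => F n (map v ts)
  end.
exists v; split; last by exists (GenTree.Leaf 0%N).
split=> [t r|f m e r e0].
  by exists (GenTree.Node (pickle (inl t : cterm + cform * nat * nat)%type) r);
    rewrite /= /F pickleK.
have [j ej] := natr_ge e^-1.
exists (GenTree.Node (pickle (inr (f, m, j) : cterm + cform * nat * nat)%type) r);
  rewrite /= /F pickleK; have [//= h1 h2] := gP (f, m, j, map v r).
apply: le_trans h2; rewrite lerD2l lerN2.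
rewrite -[leRHS]invrK lef_pV2 ?posrE ?invr_gt0// (le_trans ej)//.
by rewrite ler_nat.
Qed.

Section Hull.
Variables (R : realType) (M : structure R) (I : Type) (v : I -> M).
Hypotheses (T : tame M) (hv : skolem_hull v).

(** The approximating members must lie in the same domain [n]. An element of [dom n] that is only a
    limit of members of larger domains would not be reached by quantifiers over [dom n]. *)
Definition hull_dom n (x : M) := dom n x /\
  forall e, 0 < e -> exists2 i, dom n (v i) & mdist x (v i) <= e.

Definition hull : Type := {x : M | `[< exists n, hull_dom n x >]}.
HB.instance Definition _ := Choice.on hull.
Implicit Types x y z : hull.

Definition hull_val x : M := val x.
Local Notation hval := hull_val.

Lemma hull_val_inj : injective hval. Proof. exact: val_inj. Qed.

Definition mk_hull (a : M) (h : exists n, hull_dom n a) : hull :=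
  exist _ a (asboolT h).

Lemma hull_cover x : exists n, hull_dom n (hval x).
Proof. by have /asboolP := valP x. Qed.

Definition hull_dist x y := mdist (hval x) (hval y).

Lemma hull_distxx x : hull_dist x x = 0. Proof. exact: mdistxx. Qed.

Lemma hull_dist_positivity x y : hull_dist x y = 0 -> x = y.
Proof. by move/mdist_positivity/hull_val_inj. Qed.

Lemma hull_dist_sym x y : hull_dist x y = hull_dist y x.
Proof. exact: metric_sym. Qed.

Lemma hull_dist_triangle y x z :
  hull_dist x z <= hull_dist x y + hull_dist y z.
Proof. exact: metric_triangle. Qed.

HB.instance Definition _ := @isMetric.Build R hull
  hull_dist hull_distxx hull_dist_positivity hull_dist_sym hull_dist_triangle.

Lemma mdist_hull x y : mdist x y = mdist (hval x) (hval y).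
Proof. by []. Qed.

Lemma hull_dom_v n i : dom n (v i) -> hull_dom n (v i).
Proof. by move=> ni; split=> // e e0; exists i; rewrite ?mdistxx// ltW. Qed.

Lemma hull_dom_mono m n a : (m <= n)%N -> hull_dom m a -> hull_dom n a.
Proof.
move=> mn [ma H]; split=> [|e /H[i mi ai]]; first exact: tame_dom ma.
by exists i => //; exact: tame_dom mi.
Qed.

Lemma hull_dom_zero : hull_dom 0 (op_zero M).
Proof.
have [i vi] := hv.1 CZero [::]; rewrite -[op_zero M]vi.
by apply: hull_dom_v; rewrite vi; exact: dom_zero.
Qed.

Lemma hull_dom_one : hull_dom 1 (op_one M).
Proof.
have [i vi] := hv.1 COne [::]; rewrite -[op_one M]vi.
by apply: hull_dom_v; rewrite vi; exact: dom_one.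
Qed.

Lemma hull_dom_add m n a b :
  hull_dom m a -> hull_dom n b -> hull_dom (m + n) (op_add a b).
Proof.
move=> [ma Ha] [nb Hb]; split=> [|e e0]; first exact: dom_add.
have e20 : 0 < e / 2 by rewrite divr_gt0.
have [i mi ai] := Ha _ e20; have [j nj bj] := Hb _ e20.
have [k vk] := hv.1 (CAdd (CVar 0) (CVar 1)) [:: i; j].
exists k; rewrite vk /=; first exact: dom_add.
by rewrite (splitr e) (le_trans (mod_add ma mi nb nj))// lerD.
Qed.

Lemma hull_dom_mul m n a b :
  hull_dom m a -> hull_dom n b -> hull_dom (m * n) (op_mul a b).
Proof.
move=> [ma Ha] [nb Hb]; split=> [|e e0]; first exact: dom_mul.
pose K : R := m%:R + n%:R + 1.
have K0 : 0 < K by rewrite /K ltr_wpDl ?addr_ge0.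
have d0 : 0 < e / K by rewrite divr_gt0.
have [i mi ai] := Ha _ d0; have [j nj bj] := Hb _ d0.
have [k vk] := hv.1 (CMul (CVar 0) (CVar 1)) [:: i; j].
exists k; rewrite vk /=; first exact: dom_mul.
apply: le_trans (mod_mul ma mi nb nj) _.
have := ler_wpM2l (ler0n R n) ai; have := ler_wpM2l (ler0n R m) bj.
have : e = K * (e / K) by rewrite mulrC divfK ?gt_eqF.
have := ltW d0; rewrite {3}/K; set y := e / K => y0 -> h1 h2.
by rewrite !mulrDl mul1r; lra.
Qed.

Lemma hull_dom_star n a : hull_dom n a -> hull_dom n (op_star a).
Proof.
move=> [na Ha]; split=> [|e e0]; first exact: dom_star.
have [i ni ai] := Ha _ e0; have [k vk] := hv.1 (CStar (CVar 0)) [:: i].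
exists k; rewrite vk /=; first exact: dom_star.
exact: le_trans (mod_star na ni) _.
Qed.

(** The family is closed under rational scalars only; an arbitrary [l] is reached in the limit.
    Rounding the scalar and approximating [a] cost at most [e / 2] each. *)
Lemma hull_dom_scale m n l a :
  normc l * m%:R <= n%:R -> hull_dom m a -> hull_dom n (op_scale l a).
Proof.
move=> lmn [ma Ha]; split=> [|e e0]; first exact: dom_scale lmn _.
have [K HK] := natr_ge (normc l + m%:R + 1).
have l0 := normc_ge0 l; have m0 : 0 <= m%:R :> R by [].
have K0 : 0 < K%:R :> R by lra.
have d0 : 0 < e / K%:R / 2 by rewrite !divr_gt0.
have [q [q1 q2]] := rat_scalar_toward_zero l d0.
have [i mi ai] := Ha _ d0; have [k vk] := hv.1 (CScale q (CVar 0)) [:: i].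
exists k; rewrite vk /=.
  by apply: dom_scale mi; apply: le_trans lmn; rewrite ler_wpM2r.
apply: le_trans (metric_triangle _ (op_scale l (v i)) _) _.
apply: le_trans (lerD (mod_scale _ ma mi) (T.2 _ _ _ _ mi)) _.
have -> : e = K%:R * (e / K%:R / 2) + K%:R * (e / K%:R / 2) by field; rewrite gt_eqF.
rewrite lerD//.
  by rewrite ler_pM ?mdist_ge0//; lra.
by rewrite mulrC ler_pM ?normc_ge0//; lra.
Qed.

Lemma hull_dom_sigma n a : hull_dom n a -> hull_dom n (op_sigma a).
Proof.
move=> [na Ha]; split=> [|e e0]; first exact: dom_sigma.
have [i ni ai] := Ha _ e0; have [k vk] := hv.1 (CSigma (CVar 0)) [:: i].
exists k; rewrite vk /=; first exact: dom_sigma.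
exact: le_trans (mod_sigma na ni) _.
Qed.

Lemma hull_add_subproof x y : exists n, hull_dom n (op_add (hval x) (hval y)).
Proof.
have [m mx] := hull_cover x; have [n ny] := hull_cover y; exists (m + n)%N.
exact: hull_dom_add.
Qed.

Lemma hull_mul_subproof x y : exists n, hull_dom n (op_mul (hval x) (hval y)).
Proof.
have [m mx] := hull_cover x; have [n ny] := hull_cover y; exists (m * n)%N.
exact: hull_dom_mul.
Qed.

Lemma hull_star_subproof x : exists n, hull_dom n (op_star (hval x)).
Proof. by have [n nx] := hull_cover x; exists n; exact: hull_dom_star. Qed.

Lemma hull_scale_subproof l x : exists n, hull_dom n (op_scale l (hval x)).
Proof.
have [m mx] := hull_cover x; have [n Hn] := natr_ge (normc l * m%:R).
by exists n; exact: hull_dom_scale Hn _.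
Qed.

Lemma hull_sigma_subproof x : exists n, hull_dom n (op_sigma (hval x)).
Proof. by have [n nx] := hull_cover x; exists n; exact: hull_dom_sigma. Qed.

Definition hull_zero := mk_hull (ex_intro _ 0%N hull_dom_zero).
Definition hull_one := mk_hull (ex_intro _ 1%N hull_dom_one).
Definition hull_add x y := mk_hull (hull_add_subproof x y).
Definition hull_mul x y := mk_hull (hull_mul_subproof x y).
Definition hull_star x := mk_hull (hull_star_subproof x).
Definition hull_scale l x := mk_hull (hull_scale_subproof l x).
Definition hull_sigma x := mk_hull (hull_sigma_subproof x).

Definition hdom n : set hull := [set x | hull_dom n (hval x)].

Lemma hdom_bounded n x y : hdom n x -> hdom n y -> mdist x y <= (2 * n)%N%:R.
Proof. by move=> [nx _] [ny _]; exact: dom_bounded. Qed.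

Lemma hdom_complete n (u : nat -> hull) : (forall k, hdom n (u k)) ->
  cauchy (u @ \oo) -> exists2 x, hdom n x & u @ \oo --> x.
Proof.
move=> un /cauchy_mdistP uC.
have [||a na /cvg_mdistP ua] := @dom_complete R M n (hval \o u).
- by move=> k; case: (un k).
- exact/cauchy_mdistP.
have ha : hull_dom n a.
  split=> // e e0; have e20 : 0 < e / 2 by rewrite divr_gt0.
  have [N /(_ _ (leqnn N)) aN] := ua _ e20; have [_ /(_ _ e20)[i ni uN]] := un N.
  exists i => //; apply: le_trans (metric_triangle _ (hval (u N)) _) _.
  by rewrite (splitr e) lerD// ltW.
exists (mk_hull (ex_intro _ n ha)) => //.
exact/cvg_mdistP.
Qed.

Lemma hdom_add m n x y : hdom m x -> hdom n y -> hdom (m + n) (hull_add x y).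
Proof. exact: hull_dom_add. Qed.

Lemma hdom_mul m n x y : hdom m x -> hdom n y -> hdom (m * n) (hull_mul x y).
Proof. exact: hull_dom_mul. Qed.

Lemma hdom_star n x : hdom n x -> hdom n (hull_star x).
Proof. exact: hull_dom_star. Qed.

Lemma hdom_scale m n l x :
  normc l * m%:R <= n%:R -> hdom m x -> hdom n (hull_scale l x).
Proof. exact: hull_dom_scale. Qed.

Lemma hdom_sigma n x : hdom n x -> hdom n (hull_sigma x).
Proof. exact: hull_dom_sigma. Qed.

Lemma hmod_add m n x x' y y' : hdom m x -> hdom m x' -> hdom n y -> hdom n y' ->
  mdist (hull_add x y) (hull_add x' y') <= mdist x x' + mdist y y'.
Proof. by move=> [mx _] [mx' _] [ny _] [ny' _]; exact: mod_add mx mx' ny ny'. Qed.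

Lemma hmod_mul m n x x' y y' : hdom m x -> hdom m x' -> hdom n y -> hdom n y' ->
  mdist (hull_mul x y) (hull_mul x' y') <= n%:R * mdist x x' + m%:R * mdist y y'.
Proof. by move=> [mx _] [mx' _] [ny _] [ny' _]; exact: mod_mul mx mx' ny ny'. Qed.

Lemma hmod_star n x y : hdom n x -> hdom n y ->
  mdist (hull_star x) (hull_star y) <= mdist x y.
Proof. by move=> [nx _] [ny _]; exact: mod_star nx ny. Qed.

Lemma hmod_scale n l x y : hdom n x -> hdom n y ->
  mdist (hull_scale l x) (hull_scale l y) <= normc l * mdist x y.
Proof. by move=> [nx _] [ny _]; exact: mod_scale nx ny. Qed.

Lemma hmod_sigma n x y : hdom n x -> hdom n y ->
  mdist (hull_sigma x) (hull_sigma y) <= mdist x y.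
Proof. by move=> [nx _] [ny _]; exact: mod_sigma nx ny. Qed.

Definition hull_structure : structure R :=
  @Structure R hull hdom hull_zero hull_one hull_add hull_mul hull_star
    hull_scale hull_sigma hull_cover hdom_bounded hdom_complete hull_dom_zero
    hull_dom_one hdom_add hdom_mul hdom_star hdom_scale hdom_sigma hmod_add
    hmod_mul hmod_star hmod_scale hmod_sigma.
Local Notation N := hull_structure.

Lemma hull_tame : tame N.
Proof.
split=> [n x|n l l' x [nx _]]; first exact: hull_dom_mono.
exact: T.2 nx.
Qed.

Lemma cterm_val_hull (s : seq N) t :
  hval (cterm_val s t) = cterm_val (map hval s) t.
Proof.
elim: t => //= [n|t <- u <-|t <- u <-|t <-|q t <-|t <-]//.
by rewrite (@nth_map_default _ _ hval (op_zero N)).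
Qed.

(** One [L] serves all precisions, so that a Lipschitz constant can be fixed before [d] is chosen in
    terms of it. *)
Lemma hull_env (s : seq N) : exists L, env_dom L (map hval s) /\
  forall d, 0 < d -> exists r, env_dom L (map v r) /\
    env_close d (map hval s) (map v r).
Proof.
elim: s => [|x s [L [sL sd]]].
  exists 0%N; split=> [|d d0]; first exact: env_dom_nil.
  exists [::]; split; first exact: env_dom_nil.
  by move=> i; rewrite mdistxx ltW.
have [n [nx xd]] := hull_cover x; exists (maxn n L).
split=> [|d d0]; first exact: env_dom_cons.
have [i ni xi] := xd _ d0; have [r [rL rs]] := sd _ d0; exists (i :: r).
by split; [exact: env_dom_cons|case].
Qed.

Theorem tarski_vaught (s : seq N) f : cform_val s f = cform_val (map hval s) f.
Proof.
elim: f s => /= [t u|//|f IHf g IHg|f IHf g IHg|q f IHf|m f IHf] s.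
- by rewrite [LHS]mdist_hull !cterm_val_hull.
- by rewrite IHf IHg.
- by rewrite IHf IHg.
- by rewrite IHf.
have [L [sL sd]] := hull_env s.
have bN := @cform_has_sup R N s f m hull_tame.
have bM := cform_has_sup (map hval s) f m T.
apply/eqP; rewrite eq_le; apply/andP; split.
  apply: ge_sup; first by case: bN.
  move=> _ [x [mx _] <-]; rewrite IHf; apply: ub_le_sup; first by case: bM.
  by exists (hval x).
apply/ler_addgt0Pr => e e0.
have [K HK] := cform_lipschitz R f (maxn m L).
have [B HB] := cform_bounded R f (maxn m L).
(* The parameters are moved into the family and back, at cost [K * d] each time, and the witness
   found there is optimal up to [d]. *)
pose d : R := e / (2 * K%:R + 1).
have K0 : 0 < 2 * K%:R + 1 :> R by rewrite ltr_wpDl ?mulr_ge0.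
have d0 : 0 < d by rewrite divr_gt0.
have ed : e = 2 * (K%:R * d) + d by rewrite /d; field; rewrite gt_eqF.
have [r [rL rs]] := sd _ d0.
have close a : dom m a -> `|cform_val (a :: map hval s) f -
    cform_val (a :: map v r) f| <= K%:R * d.
  move=> ma; apply: HK; rewrite ?ltW//; try exact: env_dom_cons.
  exact: env_close_cons (ltW d0) rs.
have [i mi iS] := hv.2 f m d r d0.
have A0 : @dom R M m !=set0 by exists (op_zero M); exact: tame_dom0.
have bd (q : seq M) a : env_dom L q -> dom m a -> `|cform_val (a :: q) f| <= B%:R.
  by move=> qL ma; apply: HB => //; exact: env_dom_cons.
have := dist_sup_le A0 (fun a => bd _ a sL) (fun a => bd _ a rL) close.
rewrite ler_norml => /andP[_ Sr].
have := close _ mi; rewrite ler_norml => /andP[vi _].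
pose x : hull := mk_hull (ex_intro _ m (hull_dom_v mi)).
have : cform_val ((x : N) :: s) f <= sup [set cform_val ((x : N) :: s) f | x in dom m].
  by apply: ub_le_sup; [case: bN|exists x => //; exact: hull_dom_v].
rewrite IHf /= ed; move: Sr iS vi; lra.
Qed.

End Hull.

Theorem lowenheim_skolem (R : realType) (M : structure R) (x0 : M) : tame M ->
  exists N : structure R, [/\ tame N, separable N,
    forall f, cform_val ([::] : seq N) f = cform_val ([::] : seq M) f &
    exists h : N -> M, [/\ forall x y, mdist (h x) (h y) = mdist x y,
      forall x, h (op_sigma x) = op_sigma (h x) & exists x, h x = x0]].
Proof.
move=> T; have [v [hv [i0 vi0]]] := skolem_hull_exists x0 T.
exists (hull_structure T hv); split.
- exact: hull_tame.
- have /choice[g gv] : forall i, exists x : hull v, hull_val x = v i.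
    move=> i; have [n ni] := dom_cover (v i).
    by exists (mk_hull (ex_intro _ n (hull_dom_v ni))).
  exists (range g); split.
    exact: card_le_trans (card_image_le _ _) (countableP _).
  move=> O [x Ox] oO; have /nbhs_ballP[e /= e0 eO] : nbhs x O.
    by apply: open_nbhs_nbhs; split.
  have e20 : 0 < e / 2 by rewrite divr_gt0.
  have [n [nx /(_ _ e20)[i ni xi]]] := hull_cover x.
  exists (g i); split; last by exists i.
  apply: eO; rewrite ballEmdist /= mdist_hull gv (le_lt_trans xi)//.
  by rewrite ltr_pdivrMr// ltr_pMr// ltr1n.
- by move=> f; rewrite tarski_vaught.
- exists (@hull_val R M _ v); split=> //.
  have [n ni] := dom_cover (v i0).
  by exists (mk_hull (ex_intro _ n (hull_dom_v ni))); rewrite -vi0.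
Qed.

(** * Odometers *)

Section Cylinders.
Variable K : nat -> topologicalType.
Hypothesis Kd : forall i (x : K i), nbhs x [set x].
Local Notation X := (prod_topology K).

Definition cylinder m (x : X) : set X :=
  [set y | forall i, (i < m)%N -> y i = x i].

(** Discrete factors make a condition on finitely many coordinates open. Conversely, the cylinders
    around [x] generate a filter converging to [x] in each coordinate, hence in the product
    topology, which is the supremum of the coordinate topologies. *)
Lemma nbhs_cylinder (x : X) V : nbhs x V <-> exists m, cylinder m x `<=` V.
Proof.
have FN : Filter (nbhs x) by exact: nbhs_filter.
split=> [xV|[m mV]]; last first.
  apply: filterS mV _.
  have := @filter_forall X 'I_m (fun i y => y (val i) = x (val i)) (nbhs x) FN
    (fun i => @proj_continuous nat K (val i) x _ (Kd (x (val i)))).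
  apply: (@filterS _ _ FN) => y Hy i im; exact: (Hy (Ordinal im)).
pose F : set_system X := filter_from [set: nat] (fun m => cylinder m x).
have FF : Filter F.
  apply: filter_from_filter; first by exists 0%N.
  move=> i j _ _; exists (maxn i j) => // y Hy.
  by split=> k kl; apply: Hy; rewrite leq_max kl ?orbT.
have Fx : F --> x.
  apply/cvg_sup => i W; rewrite nbhsE => -[B [[C oC CB] Bx] BW].
  exists i.+1 => // y Hy; apply: BW; rewrite -CB /=.
  by rewrite (Hy i (ltnSn i)); move: Bx; rewrite -CB.
by have [m _ mV] := Fx V xV; exists m.
Qed.

End Cylinders.

Lemma cylinder_continuous (K L : nat -> topologicalType) :
  (forall i (x : K i), nbhs x [set x]) -> (forall i (x : L i), nbhs x [set x]) ->
  forall g : prod_topology K -> prod_topology L,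
  (forall m x, exists n, forall y, cylinder n x y -> cylinder m (g x) (g y)) ->
  continuous g.
Proof.
move=> Kd Ld g gP x V /(nbhs_cylinder Ld)[m mV].
by have [n Hn] := gP m x; apply/(nbhs_cylinder Kd); exists n => y /Hn/mV.
Qed.

Lemma nbhs_bool (b : bool) : nbhs b [set b].
Proof. exact: discrete_set1. Qed.

(** * The adding machine on prefixes *)

Section AddingMachineFacts.
Variables (a : nat -> nat) (a_ge2 : forall n, (2 <= a n)%N).
Local Notation X := (odometer_space a).
Local Notation am := (@adding_machine a a_ge2).
Implicit Types b c : X.

Lemma nbhs_digit i (x : discrete_topology 'I_(a i)) : nbhs x [set x].
Proof. exact: discrete_set1. Qed.

Lemma odometer_space_compact : compact [set: X].
Proof.
have := @tychonoff nat (fun n => discrete_topology 'I_(a n)) (fun=> setT).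
rewrite (_ : [set f | _] = setT); last by apply/seteqP; split.
apply=> i; apply: finite_compact; exact: finite_finset.
Qed.

Definition carry b k := [forall j : 'I_k, (digit b j).+1 == a j].

(** Turns the search for the least non-maximal digit into addition with carry. This form covers the
    overflow to zero as well, and shows that a digit of the image depends only on digits up to the
    same position. *)
Lemma adding_machineE b k : digit (am b) k =
  (if carry b k then if (digit b k).+1 == a k then 0%N else (digit b k).+1
   else digit b k) :> nat.
Proof.
have max j : ~~ (digit b j < a j - 1)%N = ((digit b j).+1 == a j).
  have := ltn_ord (digit b j); have := a_ge2 j; rewrite -leqNgt.
  by move: (nat_of_ord _) => d; rewrite eqn_leq; lia.
rewrite /digit /adding_machine; case: pselect => [ex|nex]; last first.
  have mx j : (digit b j).+1 == a j.
    by rewrite -max; apply/negP => H; apply: nex; exists j.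
  rewrite (_ : carry b k); last by apply/forallP.
  by rewrite mx.
case: ex_minnP => n bn nmin.
have lt_max j : (j < n)%N -> (digit b j).+1 == a j.
  by move=> jn; rewrite -max; apply/negP => /nmin; rewrite leqNgt jn.
case: ltngtP => [kn|nk|->].
- rewrite (_ : carry b k); last first.
    by apply/forallP => j; apply: lt_max; exact: ltn_trans (ltn_ord j) kn.
  by rewrite (lt_max _ kn).
- rewrite (_ : carry b k = false)//; apply/negP => /forallP/(_ (Ordinal nk)) /=.
  by rewrite -max bn.
- rewrite (_ : carry b n); last by apply/forallP => j; exact: lt_max.
  move: (bn); rewrite -[(_ < _)%N]negbK max => /negbTE ->.
  rewrite val_insubd ifT//.
  have := ltn_ord (digit b n); rewrite leq_eqVlt => /predU1P[E|//].
  by move: bn; rewrite -[(_ < _)%N]negbK max E eqxx.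
Qed.

Lemma adding_machine_prefix m b c : cylinder m b c -> cylinder m (am b) (am c).
Proof.
move=> bc i im; apply: val_inj; rewrite /= !adding_machineE /digit (bc i im).
rewrite (_ : carry c i = carry b i)//; apply: eq_forallb => j.
by rewrite /digit bc// (ltn_trans (ltn_ord j) im).
Qed.

(** By induction the earlier digits agree, so both points have the same carry at position [m]; there
    the digit is either kept or cyclically increased, and both maps are injective. *)
Lemma adding_machine_prefix_inj m b c :
  cylinder m (am b) (am c) -> cylinder m b c.
Proof.
elim: m => [//|m IH] H.
have bc : cylinder m b c by apply: IH => i im; exact: H (ltnW im).
move=> i; rewrite ltnS leq_eqVlt => /predU1P[->|]; last exact: bc.
have := congr1 val (H m (ltnSn m)); rewrite /= !adding_machineE.
rewrite (_ : carry c m = carry b m); last first.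
  by apply: eq_forallb => j; rewrite /digit bc.
move=> E; apply: val_inj => /=; move: E; rewrite /digit; case: ifP => // _.
by case: eqP => [c1|_]; case: eqP => [b1|_] // E; apply: succn_inj; rewrite ?c1 ?b1.
Qed.

Local Notation prefixes m := {dffun forall i : 'I_m, 'I_(a i)}.

Definition prefix m b : prefixes m := [ffun i : 'I_m => digit b i].

Definition prefix_point m (w : prefixes m) : X := fun i =>
  match pselect (i < m)%N with
  | left im => w (Ordinal im)
  | right _ => zero_digit a_ge2 i
  end.

Lemma prefix_cylinder m b c : prefix m b = prefix m c <-> cylinder m b c.
Proof.
split=> [E i im|bc].
  by have := congr1 (fun w : prefixes m => w (Ordinal im)) E; rewrite !ffunE.
by apply/ffunP => i; rewrite !ffunE /digit bc.
Qed.

Lemma prefix_pointK m : cancel (@prefix_point m) (prefix m).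
Proof.
move=> w; apply/ffunP => -[i im]; rewrite ffunE /digit /prefix_point /=.
by case: pselect => // im'; rewrite (bool_irrelevance im' im).
Qed.

(* The adding machine induces a permutation of the finitely many prefixes of
   length [m]. *)
Lemma adding_machine_periodic m : exists n, (0 < n)%N /\
  forall b, cylinder m b (iter n am b).
Proof.
pose g (w : prefixes m) : prefixes m := prefix m (am (prefix_point w)).
have gE b : prefix m (am b) = g (prefix m b).
  apply/prefix_cylinder/adding_machine_prefix/prefix_cylinder.
  by rewrite prefix_pointK.
have ginj : injective g.
  move=> w w' /prefix_cylinder/adding_machine_prefix_inj/prefix_cylinder.
  by rewrite !prefix_pointK.
exists #[perm ginj]%g; split=> [|b]; first exact: order_gt0.
apply/prefix_cylinder.
have iterE n : prefix m (iter n am b) = iter n g (prefix m b).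
  by elim: n => //= n IH; rewrite gE IH.
have := congr1 (fun s : {perm prefixes m} => s (prefix m b))
  (expg_order (perm ginj)).
rewrite permX perm1 iterE => {1}<-.
by apply: eq_iter => w; rewrite permE.
Qed.

End AddingMachineFacts.

(** * Almost periods of continuous functions on an odometer *)

Section NearPeriodicity.
Variables (R : realType) (S : continuousType cantor_space cantor_space).
Local Notation CX := (cfun R cantor_space_compact).

Lemma iter_comp_cfun n (f : CX) x :
  eval_cfun (iter n (comp_cfun S) f) x = eval_cfun f (iter n S x).
Proof.
by elim: n x => [//|n IH] x; rewrite [in RHS]iterSr -IH.
Qed.

Lemma odometer_nearly_periodic (f : CX) : odometer S ->
  exists n, (0 < n)%N /\ cdist (iter n (comp_cfun S) f) f <= 2^-1.
Proof.
move=> [a [a_ge2 [h [ch [g [cg hK gK]]] hS]]].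
(* Compactness yields one prefix length [m] such that [f] pulled back along [h] varies by at most
   1/2 on every cylinder of length [m]: continuity with 1/4 at a centre is used for both points. *)
have := @odometer_space_compact a; move/compact_near_coveringP.
move=> /(_ _ \oo (fun m b => forall c, cylinder m b c ->
  normc (eval_cfun f (h b) - eval_cfun f (h c)) <= 2^-1) _) [].
  move=> b _; have : continuous (fun b => eval_cfun f (h b)).
    by move=> c; apply: continuous_comp; [exact: ch|exact: cfun_cts].
  have e0 : 0 < 4^-1 :> R by rewrite invr_gt0.
  move=> /(_ b)/ccvgP/(_ _ e0) H.
  have [m mP] := (nbhs_cylinder (@nbhs_digit a) b _).1 H.
  exists (cylinder m b, [set n | (m <= n)%N]).
    by split; [apply/(nbhs_cylinder (@nbhs_digit a)); exists m|exists m].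
  move=> [c n] /= [bc mn] d cd.
  apply: le_trans (normc_triangle (eval_cfun f (h b)) _ _) _.
  have -> : 2^-1 = 4^-1 + 4^-1 :> R by field.
  rewrite lerD//; first by rewrite normcB ltW// mP.
  rewrite ltW// mP// => i im.
  by rewrite (cd _ (leq_trans im mn)) bc.
move=> m _ /(_ m (leqnn m)) mP.
have [n [n0 nP]] := adding_machine_periodic a_ge2 m.
exists n; split=> //; apply: cdist_le; first by rewrite invr_ge0.
move=> x; rewrite iter_comp_cfun -(gK x) -(hK (g x)).
have iterE b : iter n S (h b) = h (iter n (@adding_machine a a_ge2) b).
  by elim: (n) => //= k ->; exact/esym/hS.
by rewrite hK iterE normcB; apply: mP.
Qed.

End NearPeriodicity.

(** * The binary odometer on the Cantor space *)

Definition cantor_succ (c : cantor_space) : cantor_space :=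
  fun i => c i (+) [forall j : 'I_i, c j].

(** Subtraction of 1: the borrow reaches digit [i] when all lower digits are 0. *)
Definition cantor_pred (c : cantor_space) : cantor_space :=
  fun i => c i (+) [forall j : 'I_i, ~~ c j].

Lemma forall_ord_recr n (P : pred nat) :
  [forall j : 'I_n.+1, P j] = [forall j : 'I_n, P j] && P n.
Proof.
apply/forallP/andP => [H|[/forallP H Pn] j].
  split; last exact: (H ord_max).
  by apply/forallP => j; exact: (H (widen_ord (leqnSn n) j)).
have := ltn_ord j; rewrite ltnS leq_eqVlt => /predU1P[->//|jn].
exact: (H (Ordinal jn)).
Qed.

Lemma cantor_succK : cancel cantor_succ cantor_pred.
Proof.
move=> c; apply: functional_extensionality_dep => i; rewrite /cantor_pred.
(* The carry reaches digit [i] exactly when it has turned all lower digits into 0, which is when the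
   borrow reaches digit [i] on the way back. *)
suff -> : [forall j : 'I_i, ~~ cantor_succ c j] = [forall j : 'I_i, c j].
  by rewrite /cantor_succ addbK.
elim: i => [|i IH]; first by apply: eq_forallb => -[].
rewrite (forall_ord_recr _ (fun j => ~~ cantor_succ c j)) (forall_ord_recr _ (fun j => c j)).
rewrite IH /cantor_succ.
by case: [forall j : 'I_i, c j]; case: (c i).
Qed.

Lemma cantor_predK : cancel cantor_pred cantor_succ.
Proof.
move=> c; apply: functional_extensionality_dep => i; rewrite /cantor_succ.
suff -> : [forall j : 'I_i, cantor_pred c j] = [forall j : 'I_i, ~~ c j].
  by rewrite /cantor_pred addbK.
elim: i => [|i IH]; first by apply: eq_forallb => -[].
rewrite (forall_ord_recr _ (fun j => cantor_pred c j)) (forall_ord_recr _ (fun j => ~~ c j)).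
rewrite IH /cantor_pred.
by case: [forall j : 'I_i, ~~ c j]; case: (c i).
Qed.

Lemma cantor_succ_continuous : continuous cantor_succ.
Proof.
apply: (cylinder_continuous (fun=> nbhs_bool) (fun=> nbhs_bool)) => m x.
exists m => y xy i im; rewrite /cantor_succ xy//; congr (_ (+) _).
by apply: eq_forallb => j; rewrite xy// (ltn_trans (ltn_ord j) im).
Qed.

Lemma cantor_pred_continuous : continuous cantor_pred.
Proof.
apply: (cylinder_continuous (fun=> nbhs_bool) (fun=> nbhs_bool)) => m x.
exists m => y xy i im; rewrite /cantor_pred xy//; congr (_ (+) _).
by apply: eq_forallb => j; rewrite xy// (ltn_trans (ltn_ord j) im).
Qed.

Definition cantor_succ_cts : continuousType cantor_space cantor_space :=
  mkcts cantor_succ_continuous.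

Lemma cantor_succ_homeomorphism : homeomorphism cantor_succ_cts.
Proof.
split; first exact: cantor_succ_continuous.
exists cantor_pred; split; [exact: cantor_pred_continuous|
  exact: cantor_succK|exact: cantor_predK].
Qed.

Lemma cantor_succ_odometer : odometer cantor_succ_cts.
Proof.
exists (fun=> 2%N), (fun=> isT).
pose h (b : odometer_space (fun=> 2%N)) : cantor_space :=
  fun i => digit b i == 1%N :> nat.
pose g (c : cantor_space) : odometer_space (fun=> 2%N) :=
  fun i => inord (c i).
have dP (b : odometer_space (fun=> 2%N)) i : digit b i = (h b i) :> nat.
  by rewrite /h; case: (digit b i) => -[|[|]].
exists h; last first.
  move=> b; apply: functional_extensionality_dep => i.
  rewrite -[LHS]/(h (@adding_machine (fun=> 2%N) (fun=> isT) b) i).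
  rewrite -[RHS]/(cantor_succ (h b) i).
  rewrite /cantor_succ; have -> : [forall j : 'I_i, h b j] = carry b i.
    by apply: eq_forallb => j; rewrite dP; case: (h b j).
  have := @adding_machineE (fun=> 2%N) (fun=> isT) b i; rewrite !dP.
  by case: (carry b i); case: (h b i); case: (h _ i).
split.
  apply: (cylinder_continuous (@nbhs_digit (fun=> 2%N)) (fun=> nbhs_bool)) => m x.
  by exists m => y xy i im; rewrite /h /digit xy.
exists g; split.
- apply: (cylinder_continuous (fun=> nbhs_bool) (@nbhs_digit (fun=> 2%N))) => m x.
  by exists m => y xy i im; rewrite /g xy.
- move=> b; apply: functional_extensionality_dep => i.
  by apply: val_inj; rewrite /= /g inordK -?dP ?ltn_ord.
- move=> c; apply: functional_extensionality_dep => i.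
  by rewrite /h /digit /g inordK; case: (c i).
Qed.

(** The lowest digit comes first, so the orbit of the zero sequence runs through the natural
    numbers. *)
Definition binary_digits (n : nat) : cantor_space := fun i => odd (iter i half n).

Lemma cantor_succ_binary_digits n :
  cantor_succ (binary_digits n) = binary_digits n.+1.
Proof.
apply: functional_extensionality_dep => i; rewrite /cantor_succ /binary_digits.
elim: i n => [|i IH] n.
  by rewrite /= (_ : [forall _, _]) ?addbT//; apply/forallP => -[].
(* Dropping the lowest digit turns [n] into [n./2] and [n.+1] into [odd n + n./2]: the carry passes
   on exactly when [n] is odd. *)
rewrite !iterSr -[n.+1./2]/(uphalf n) uphalf_half.
have -> : [forall j : 'I_i.+1, odd (iter j half n)] =
    odd n && [forall j : 'I_i, odd (iter j half n./2)].
  apply/forallP/andP => [H|[n0 /forallP H] [[|j] ji] //=].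
    split; first exact: (H ord0).
    by apply/forallP => j; rewrite -iterSr; exact: (H (lift ord0 j)).
  by rewrite -iterS iterSr; exact: (H (Ordinal (ji : (j < i)%N))).
case: (odd n) => /=; last by rewrite addbF.
by rewrite add1n IH.
Qed.

Lemma binary_digits_eq0 k n : (n < 2 ^ k)%N ->
  [forall j : 'I_k, ~~ binary_digits n j] -> n = 0%N.
Proof.
elim: k n => [|k IH] n; first by rewrite expn0 ltnS leqn0 => /eqP.
move=> nk /forallP H; have n0 : ~~ odd n := H ord0.
rewrite -[n]odd_double_half (negbTE n0) (IH n./2)//.
  by rewrite expnS mul2n in nk; rewrite -ltn_double (leq_trans _ nk)// ltnS;
     rewrite -[leqRHS]odd_double_half leq_addl.
by apply/forallP => j; have := H (lift ord0 j); rewrite /binary_digits -iterSr.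
Qed.

Section Aperiodicity.
Variables (R : realType) (k : nat).
Local Notation CX := (cfun R cantor_space_compact).

Definition zero_prefix (c : cantor_space) : complexes R :=
  if [forall j : 'I_k, ~~ c j] then 1 else 0.

Lemma zero_prefix_continuous : continuous zero_prefix.
Proof.
move=> x; apply/ccvgP => e e0; apply/(nbhs_cylinder (fun=> nbhs_bool)).
exists k => y xy.
have E : zero_prefix y = zero_prefix x.
  rewrite /zero_prefix (_ : [forall j : 'I_k, ~~ y j] = [forall j : 'I_k, ~~ x j])//.
  by apply: eq_forallb => j; rewrite xy.
by change (normc (zero_prefix x - zero_prefix y) < e); rewrite E subrr normc0.
Qed.

Definition zero_prefix_cfun : CX := mk_cfun _ zero_prefix_continuous.

Lemma cball_zero_prefix : cball 1 zero_prefix_cfun.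
Proof.
apply: supnorm_le => // x; change (normc (zero_prefix x) <= 1%:R).
by rewrite /zero_prefix; case: [forall j : 'I_k, _]; rewrite (normc0, normc1).
Qed.

Lemma zero_prefix_aperiodic n : (0 < n <= k)%N ->
  1 <= cdist (iter n (comp_cfun cantor_succ_cts) zero_prefix_cfun) zero_prefix_cfun.
Proof.
(* The zero sequence is the test point: after [n] steps it becomes the expansion of [n], and
   [0 < n <= k < 2 ^ k] puts a digit 1 among the first [k]. *)
move=> /andP[n0 nk]; apply: le_trans (cdist_ge _ _ (binary_digits 0)).
rewrite iter_comp_cfun.
have -> : iter n cantor_succ_cts (binary_digits 0) = binary_digits n.
  by elim: (n) => //= m ->; exact: cantor_succ_binary_digits.
have zn : zero_prefix (binary_digits n) = 0.
  rewrite /zero_prefix; case: [forall j : 'I_k, _] / idP => // /binary_digits_eq0 H.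
  by move: n0; rewrite H// (leq_ltn_trans nk)// ltn_expl.
have z0 : zero_prefix (binary_digits 0) = 1.
  rewrite /zero_prefix (_ : [forall j : 'I_k, _])//; apply/forallP => j.
  by rewrite /binary_digits iter_fix.
change (1 <= normc (zero_prefix (binary_digits n) - zero_prefix (binary_digits 0))).
by rewrite zn z0 sub0r normcN normc1.
Qed.

End Aperiodicity.

(** * Non-axiomatizability *)

Lemma cfun_structure_tame (R : realType) (X : topologicalType)
    (cX : compact [set: X]) (S : continuousType X X) :
  tame (cfun_structure R cX S).
Proof.
split=> [n f|n l l' f] nf.
  by rewrite /= /cball /= (le_trans nf)// ler_nat.
apply: cdist_le => [|x]; first by rewrite mulr_ge0 ?normc_ge0.
change (normc (l * eval_cfun f x - l' * eval_cfun f x) <= normc (l - l') * n%:R).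
by rewrite -mulrBl normcM ler_wpM2l ?normc_ge0// cball_ge.
Qed.

Lemma sentence_approx (R : realType) (phi : formula R 0) e : 0 < e ->
  exists f, forall M : structure R, tame M ->
    `|sentence_value M phi - cform_val ([::] : seq M) f| <= e.
Proof.
move=> /(formula_approx phi 0)[f fP]; exists f => M tM.
by apply: fP => //; [exact: env_dom_nil|case].
Qed.

(** One countable formula approximates a sentence in both structures at once and takes the same
    value in both, so the two values of the sentence differ by arbitrarily little. *)
Lemma models_cform (R : realType) (M N : structure R) T : tame M -> tame N ->
  (forall f, cform_val ([::] : seq N) f = cform_val ([::] : seq M) f) ->
  models M T -> models N T.
Proof.
move=> tM tN MN MT phi /MT phi0; apply/eqP; rewrite -normr_eq0 eq_le normr_ge0 andbT.
apply/ler_addgt0Pr => e e0; rewrite add0r.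
have e20 : 0 < e / 2 by rewrite divr_gt0.
have [f fP] := sentence_approx phi e20.
have := fP M tM; have := fP N tN; rewrite MN phi0 sub0r !ler_norml.
by move=> /andP[? ?] /andP[? ?]; apply/andP; split; lra.
Qed.

Lemma ultrapower_cform (R : realType) (A : structure R) (U : set_system nat)
    (UU : UltraFilter U) (tA : tame A) (oU : \oo `<=` U) f :
  cform_val ([::] : seq (ultrapower_structure UU tA oU)) f =
  cform_val ([::] : seq A) f.
Proof.
have H := @los R A U UU tA oU [::] f; have PU : ProperFilter U := ultra_proper.
exact: (cvg_unique (@norm_hausdorff _ R^o) H (cvg_cst _)).
Qed.

Lemma iter_usigma (R : realType) (A : structure R) (U : set_system nat)
    (UU : UltraFilter U) (tA : tame A) (x : bounded_seq A) n :
  exists2 y : bounded_seq A, iter n (@usigma R A U UU tA) (upi UU tA x) = upi UU tA y &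
    forall k, bs_val y k = iter n (@op_sigma R A) (bs_val x k).
Proof.
elim: n => [|n [y yE yP]]; first by exists x.
exists (bs_sigma y); first by rewrite iterS yE usigmaE.
by move=> k; rewrite iterS -yP.
Qed.

Lemma aperiodic_extension (R : realType) (A : structure R) (x : nat -> A) m :
  tame A -> (forall k, dom m (x k)) ->
  (forall k n, (0 < n <= k)%N -> 1 <= mdist (iter n (@op_sigma R A) (x k)) (x k)) ->
  exists N : structure R, [/\ separable N, (forall T, models A T -> models N T) &
    exists y : N, forall n, (0 < n)%N -> 1 <= mdist (iter n (@op_sigma R N) y) y].
Proof.
move=> tA mx xP; have [U [UU oU]] := @ultraFilterLemma nat \oo _.
pose x' := mk_bs (ex_intro _ m mx).
pose M := ultrapower_structure UU tA oU.
have tM : tame M by exact: ultrapower_tame.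
have [N [tN sN NM [h [hd hs [y hy]]]]] := lowenheim_skolem (upi UU tA x' : M) tM.
exists N; split=> // [T AT|].
  by apply: (models_cform tA tN _ AT) => f; rewrite NM ultrapower_cform.
exists y => n n0; rewrite -hd.
have -> : h (iter n (@op_sigma R N) y) = iter n (@op_sigma R M) (h y).
  by elim: (n) => //= k <-; rewrite hs.
have [z zE zP] := iter_usigma UU tA x' n.
rewrite hy [iter _ _ _]zE [mdist _ _]mdist_upi; apply: (udist_near_ge UU tA).
(* The hypothesis on [x k] covers the exponent [n] only when [n <= k]; these coordinates are
   cofinite, hence in [U]. *)
have nU : U [set k | (n <= k)%N] by apply: (oU); exists n.
by apply: filterS nU => k nk; rewrite zP; apply: xP; rewrite n0.
Qed.

Theorem theorem2p5 (R : realType) :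
  ~ separably_axiomatizable (@cantor_odometer_structure R).
Proof.
move=> [T HT].
pose A := cfun_structure R cantor_space_compact cantor_succ_cts.
have KA : cantor_odometer_structure A.
  exists cantor_succ_cts; split=> //.
    exact: cantor_succ_homeomorphism.
  exact: cantor_succ_odometer.
have AA : isomorphic A A by exists id; split=> //; exists id.
have [_ AT] : separable A /\ models A T by apply/HT; exists A.
have [N [sN NT [y yP]]] := @aperiodic_extension R A
  (fun k => zero_prefix_cfun R k) 1 (cfun_structure_tame _ _ _)
  (fun k => cball_zero_prefix R k) (fun k n => @zero_prefix_aperiodic R k n).
have [_ [S [_ oS ->]] [h [_ [hd [_ [_ [_ [_ [_ [_ [_ hs]]]]]]]]]]] :
  exists2 M, cantor_odometer_structure M & isomorphic N M.
  by apply/HT; split=> //; exact: NT.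
have [n [n0 nP]] := odometer_nearly_periodic (h y) oS.
have hn : h (iter n (@op_sigma R N) y) = iter n (comp_cfun S) (h y).
  by elim: (n) => //= k <-; rewrite hs.
have := yP _ n0; rewrite -hd hn => /le_trans/(_ nP) le1.
lra.
Qed.
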